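(* Let $1\le h\le 2n$, let $\{\xi_J^h\}$ be a left-invariant basis of $E_0^h$, and let $\alpha=\sum_J\alpha_J\xi_J^h\in\Gamma(E_0^h)$ be such that $d_c\alpha=0$. (1) If $h\ne n$, then each component $\alpha_J$ of $\alpha$, $J=1,\dots,\dim E_0^h$, can be written as $$\alpha_J=\sum_{I=1}^{\dim E_0^{h+1}}\sum_{i=1}^{2n}b_{i,I}^J\,G_{I,i},$$ where the $b_{i,I}^J$ are real constants (independent of $\alpha$) and, for every $I=1,\dots,\dim E_0^{h+1}$, the $G_{I,i}$ are the components of a horizontal vector field $G_I=\sum_{i=1}^{2n}G_{I,i}W_i$ with $$\sum_{i=1}^{2n}W_iG_{I,i}=0 .$$ Moreover there exists a geometric constant $C>0$ (independent of $\alpha$) such that for $I=1,\dots,\dim E_0^{h+1}$ and $1\le p\le\infty$ $$\|G_I\|_{L^p(\mathbb{H}^n,\mathfrak{h}_1)}\le C\|\alpha\|_{L^p(\mathbb{H}^n,E_0^h)}.$$ (2) If $h=n$, then each component $\alpha_J$ of $\alpha$, $J=1,\dots,\dim E_0^n$, can be written as $$\alpha_J=\sum_{I=1}^{\dim E_0^{n+1}}\sum_{i,j=1}^{2n}b_{i,j,I}^J\,(G_I^{\mathrm{Sym}})_{i,j},$$ where the $b_{i,j,I}^J$ are real constants (independent of $\alpha$) and, for every $I=1,\dots,\dim E_0^{n+1}$, the $(G_I^{\mathrm{Sym}})_{i,j}$ are the components of the symmetric part of a horizontal $2$-tensor field $G_I=\sum_{i,j=1}^{2n}G_{I,i,j}\,W_i\otimes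 W_j$ that satisfies $$\sum_{i,j=1}^{2n}W_iW_j\,G_{I,i,j}=0 .$$ Moreover there exists a geometric constant $C>0$ (independent of $\alpha$) such that for $I=1,\dots,\dim E_0^{n+1}$ and $1\le p\le\infty$ $$\|G_I\|_{L^p(\mathbb{H}^n,\otimes^2\mathfrak{h}_1)}\le C\|\alpha\|_{L^p(\mathbb{H}^n,E_0^n)}.$$
   Context: **Heisenberg group.** $\mathbb{H}^n=\mathbb{R}^{2n+1}$ ($n\ge1$) with points $p=(x,y,t)$, $x,y\in\mathbb{R}^n$, $t\in\mathbb{R}$, and group law $(x,y,t)\cdot(x',y',t')=(x+x',y+y',t+t'+\frac12\sum_{j=1}^n(x_jy_j'-y_jx_j'))$. The Lie algebra $\mathfrak{h}$ of left-invariant vector fields has basis $W_i=X_i=\partial_{x_i}-\frac12y_i\partial_t$, $W_{i+n}=Y_i=\partial_{y_i}+\frac12x_i\partial_t$ ($1\le i\le n$), $W_{2n+1}=T=\partial_t$; the horizontal layer is $\mathfrak{h}_1=\mathrm{span}(W_1,\dots,W_{2n})$. Horizontal vector fields are fields $\sum_{i\le 2n}G_iW_i$ with $G_i$ functions; horizontal $2$-tensor fields are $\sum_{i,j\le2n}G_{i,j}W_i\otimes W_j$, i.e. sections of $\otimes^2\mathfrak{h}_1$, and the symmetric part $G^{\mathrm{Sym}}$ of $G$ has components $\frac12(G_{i,j}+G_{j,i})$. The dual basis is $\omega_i=dx_i$, $\omega_{i+n}=dy_i$, $\omega_{2n+1}=\theta=dt-\frac12\sum_j(x_jdy_j-y_jdx_j)$,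 and $d\theta=-\sum_i dx_i\wedge dy_i$. $\bigwedge^k\mathfrak{h}_1$ denotes the horizontal $k$-covectors, i.e. the span of $\omega_{i_1}\wedge\dots\wedge\omega_{i_k}$, $1\le i_1<\dots<i_k\le2n$; the scalar product on covectors makes the monomials in $\omega_1,\dots,\omega_{2n+1}$ orthonormal. **Rumin's complex.** $L\alpha=d\theta\wedge\alpha$, $L:\bigwedge^h\mathfrak{h}_1\to\bigwedge^{h+2}\mathfrak{h}_1$, and $\Lambda$ is its adjoint. For $1\le h\le n$, $E_0^h=\ker\Lambda\cap\bigwedge^h\mathfrak{h}_1$ (with $E_0^1=\bigwedge^1\mathfrak{h}_1$); for $n<h\le2n+1$, $E_0^h=\{\beta\wedge\theta:\beta\in\bigwedge^{h-1}\mathfrak{h}_1,\ L\beta=0\}$. These define left-invariant bundles over $\mathbb H^n$, still denoted $E_0^h$; $\Gamma(E_0^h)$ is the space of smooth sections (smooth differential forms with pointwise values in $E_0^h$). Rumin's differential $d_c:\Gamma(E_0^h)\to\Gamma(E_0^{h+1})$ is: for $h<n$, $d_c\alpha$ is the pointwise orthogonal projection of $d\alpha$ on $E_0^{h+1}$ ($d$ the exterior differential); for $h=n$, $d_c\alpha=d(\alpha+\beta\wedge\theta)$, where $\beta$ is the unique horizontal $(n-1)$-form with $\theta\wedge d(\alpha+\beta\wedge\theta)=0$ (existence and uniqueness since $L:\bigwedge^{n-1}\mathfrak{h}_1\to\bigwedge^{n+1}\mathfrak{h}_1$ is an isomorphism); for $n<h\le2n$, $d_c\alpha=d\alpha$.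 **Norms.** $L^p$-norms of sections of $E_0^h$, $\mathfrak{h}_1$, $\otimes^2\mathfrak{h}_1$ are the natural $L^p$-norms of the components with respect to left-invariant bases (Lebesgue measure on $\mathbb{H}^n$); the inequalities are trivial when the right-hand side is $+\infty$. *)

(* Defs.v *)
From HB Require Import structures.
From mathcomp Require Import all_boot all_order all_algebra.
From mathcomp Require Import all_classical all_reals all_analysis.

Set Implicit Arguments.
Unset Strict Implicit.
Unset Printing Implicit Defensive.

Import Order.TTheory GRing.Theory Num.Theory.
Import numFieldNormedType.Exports.

Local Open Scope classical_set_scope.
Local Open Scope ring_scope.

Section Lebesgue.
Variable R : realType.

Record measured_space := MeasuredSpace {
  ms_display : measure_display;
  ms_sort : measurableType ms_display;
  ms_measure : {measure set ms_sort -> \bar R} }.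

(* The N-fold product ((unit * R) * ...) * R, with the N-fold product of the
   Lebesgue measure of R. *)
Fixpoint lebesgue_space (N : nat) : measured_space :=
  if N is N'.+1 then
    @MeasuredSpace _ (ms_sort (lebesgue_space N') * measurableTypeR R)%type
      (ms_measure (lebesgue_space N') \x @lebesgue_measure R)%E
  else MeasuredSpace (\d_tt : {measure set unit -> \bar R}).

Fixpoint space_row (N : nat) : ms_sort (lebesgue_space N) -> 'rV[R]_N :=
  match N return ms_sort (lebesgue_space N) -> 'rV[R]_N with
  | 0%N => fun=> 0
  | N'.+1 => fun z =>
      \row_(i < N'.+1)
        (if unlift ord_max i is Some j then space_row z.1 0 j else z.2)
  end.

Definition LpnormN (N : nat) (p : \bar R) (f : 'rV[R]_N -> R) : \bar R :=
  Lnorm (ms_measure (lebesgue_space N)) p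
    (fun z => (f (space_row z))%:E).

(* The L^p norm of a family of components, through its Euclidean length. *)
Definition Lpnorm (N : nat) (I : finType) (p : \bar R)
    (F : I -> 'rV[R]_N -> R) : \bar R :=
  LpnormN p (fun z => Num.sqrt (\sum_i F i z ^+ 2)).

End Lebesgue.

(* H^n = R^(2n+1), with coordinates x_1, ..., x_n, y_1, ..., y_n, t. *)
Notation Heis R n := 'rV[R]_(n + n + 1).

Section Heisenberg.
Variables (R : realType) (n : nat).
Local Notation H := (Heis R n).
Local Notation idx := 'I_(n + n + 1).

Definition ix (j : 'I_n) : idx := lshift 1 (lshift n j).
Definition iy (j : 'I_n) : idx := lshift 1 (rshift n j).
Definition it : idx := rshift (n + n) ord0.

Definition pd (i : idx) (f : H -> R) : H -> R := fun p => 'D_(delta_mx 0 i) f p.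

Definition smooth (f : H -> R) : Prop :=
  forall (s : seq idx) (p : H), differentiable (foldr pd f s) p.

(* The left-invariant fields W_i = X_i for i < n and W_(n+i) = Y_i of the group
   law (x,y,t)(x',y',t') = (x+x', y+y', t+t' + 1/2 sum_j (x_j y'_j - y_j x'_j)). *)
Definition W (i : 'I_(n + n)) (f : H -> R) : H -> R := fun p =>
  match fintype.split i with
  | inl j => pd (ix j) f p - 2^-1 * p 0 (iy j) * pd it f p
  | inr j => pd (iy j) f p + 2^-1 * p 0 (ix j) * pd it f p
  end.

(* A covector is given by its coefficients on the monomials
   e_S = e_(i_1) /\ ... /\ e_(i_k), S = {i_1 < ... < i_k}, for a basis
   (e_i) of the 1-covectors. *)
Definition covec := {ffun {set idx} -> R^o}.
HB.instance Definition _ := Vector.on covec.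

Definition mono (S : {set idx}) : covec := [ffun U => (U == S)%:R].

Definition wedge_sign (S T : {set idx}) : R :=
  (-1) ^+ #|[set ij in finset.setX S T | (ij.2 < ij.1)%N]%SET|.

Definition wedge (u v : covec) : covec :=
  [ffun U : {set idx} =>
     \sum_(S : {set idx} | S \subset U)
        wedge_sign S (U :\: S)%SET * u S * v (U :\: S)%SET].

Definition dot (u v : covec) : R := \sum_S u S * v S.

Lemma wedge_is_linear (u : covec) : linear (wedge u).
Proof.
move=> a v w; apply/ffunP => U; rewrite !ffunE scaler_sumr -big_split /=.
apply: eq_bigr => S _; rewrite !ffunE mulrDr; congr (_ + _).
by rewrite /GRing.scale /= mulrCA.
Qed.
HB.instance Definition _ (u : covec) :=
  GRing.isLinear.Build R covec covec *:%R (wedge u) (wedge_is_linear u).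

Definition wedger (v u : covec) : covec := wedge u v.

Lemma wedger_is_linear (v : covec) : linear (wedger v).
Proof.
move=> a u w; apply/ffunP => U; rewrite !ffunE scaler_sumr -big_split /=.
apply: eq_bigr => S _; rewrite !ffunE mulrDr mulrDl; congr (_ + _).
by rewrite /GRing.scale /= [in LHS]mulrCA -!mulrA.
Qed.
HB.instance Definition _ (v : covec) :=
  GRing.isLinear.Build R covec covec *:%R (wedger v) (wedger_is_linear v).

Lemma dot_is_linear (u : covec) : linear (dot u : covec -> R^o).
Proof.
move=> a v w; rewrite /dot scaler_sumr -big_split /=.
apply: eq_bigr => S _; rewrite !ffunE mulrDr; congr (_ + _).
by rewrite /GRing.scale /= mulrCA.
Qed.
HB.instance Definition _ (u : covec) :=
  GRing.isLinear.Build R covec R^o *:%R (dot u : covec -> R^o) (dot_is_linear u).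

Lemma dot_mono (u : covec) (S : {set idx}) : dot u (mono S) = u S.
Proof.
rewrite /dot (bigD1 S) //= ffunE eqxx mulr1 big1 ?addr0 // => U US.
by rewrite ffunE (negbTE US) mulr0.
Qed.

Definition adjoint (f : covec -> covec) (v : covec) : covec :=
  [ffun S => dot (f (mono S)) v].

Lemma covec_mono (u : covec) : u = \sum_S u S *: mono S.
Proof.
apply/ffunP => U; rewrite sum_ffunE (bigD1 U) //= !ffunE eqxx.
rewrite /GRing.scale /= mulr1 big1 ?addr0 // => S SU.
by rewrite !ffunE eq_sym (negbTE SU) /GRing.scale /= mulr0.
Qed.

Lemma dotC (u v : covec) : dot u v = dot v u.
Proof. by apply: eq_bigr => S _; rewrite mulrC. Qed.

Lemma adjointP (f : {linear covec -> covec}) (u v : covec) :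
  dot (f u) v = dot u (adjoint f v).
Proof.
rewrite {1}(covec_mono u) linear_sum dotC linear_sum /dot.
apply: eq_bigr => S _; rewrite linearZ linearZ /= ffunE.
by rewrite -[in RHS]dotC /GRing.scale.
Qed.

Lemma adjoint_is_linear (f : covec -> covec) : linear (adjoint f).
Proof. by move=> a u v; apply/ffunP => S; rewrite !ffunE linearP. Qed.
HB.instance Definition _ (f : covec -> covec) :=
  GRing.isLinear.Build R covec covec *:%R (adjoint f) (adjoint_is_linear f).

Definition orthv (U : {vspace covec}) : {vspace covec} :=
  (\bigcap_(u <- vbasis U) lker (linfun (dot u : covec -> R^o)))%VS.

Definition orthproj (U : {vspace covec}) : 'End(covec) := daddv_pi U (orthv U).

(* From here on a covector in [covec] that stands for a left-invariant form is
   given by its coefficients on the monomials in omega_1, ..., omega_(2n+1). *)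

Definition theta : covec := mono [set it]%SET.

Definition dtheta : covec :=
  - \sum_(j < n) wedge (mono [set ix j]%SET) (mono [set iy j]%SET).

Definition hcov (k : nat) : {vspace covec} :=
  <<[seq mono K
     | K <- enum [set K : {set idx} | (#|K| == k) && (it \notin K)]%SET]>>%VS.

Definition Lop : 'End(covec) := linfun (wedge dtheta).

(* [Lop] preserves both the horizontal covectors and the multiples of [theta],
   which are orthogonal: on horizontal covectors the adjoint on the whole
   exterior algebra is the adjoint of the restriction of [Lop]. *)
Definition Lambda : 'End(covec) := linfun (adjoint Lop).

Definition E0 (h : nat) : {vspace covec} :=
  if (h <= n)%N then (lker Lambda :&: hcov h)%VS
  else (linfun (wedger theta) @: (lker Lop :&: hcov h.-1))%VS.

(* A form is given at each point by its coefficients on the monomials in the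
   left-invariant coframe, so that constant functions are the left-invariant
   forms and wedge products, projections, etc. are taken pointwise. *)
Definition form := H -> covec.

Definition smooth_form (a : form) : Prop := forall S, smooth (fun p => a p S).

(* The coframe in the coordinate basis dx_1, ..., dx_n, dy_1, ..., dy_n, dt. *)
Definition coframe (p : H) (i : idx) : covec :=
  match fintype.split i with
  | inl _ => mono [set i]%SET
  | inr _ => mono [set it]%SET
      - 2^-1 *: \sum_(j < n) (p 0 (ix j) *: mono [set iy j]%SET
                              - p 0 (iy j) *: mono [set ix j]%SET)
  end.

(* From coefficients in the left-invariant coframe to coefficients in the
   coordinate basis, at p. *)
Definition frame (p : H) (c : covec) : covec :=
  \sum_(S : {set idx})
     c S *: \big[wedge/mono finset.set0]_(i <- enum S) coframe p i.

Lemma frame_is_linear (p : H) : linear (frame p).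
Proof.
move=> a u v; rewrite /frame scaler_sumr -big_split /=.
by apply: eq_bigr => S _; rewrite !ffunE scalerDl scalerA.
Qed.
HB.instance Definition _ (p : H) :=
  GRing.isLinear.Build R covec covec *:%R (frame p) (frame_is_linear p).

Definition coord_d (w : H -> covec) : H -> covec := fun p =>
  \sum_(i : idx) wedge (mono [set i]%SET)
                       [ffun S => pd i (fun q => w q S) p].

(* The exterior differential of R^(2n+1), conjugated by the change of frame;
   [frame p] is invertible, so that [^-1] is its inverse. *)
Definition ext_d (a : form) : form := fun p =>
  ((linfun (frame p))^-1)%VF (coord_d (fun q => frame q (a q)) p).

Definition rumin_lift (a b : form) : form := fun p => a p + wedge (b p) theta.

(* The horizontal (n-1)-form beta with theta /\ d(a + beta /\ theta) = 0. *)
Definition rumin_beta (a : form) : form :=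
  xget (fun=> 0) [set b : form |
    [/\ smooth_form b, forall p, b p \in hcov n.-1 &
        forall p, wedge theta (ext_d (rumin_lift a b) p) = 0]].

Definition dc (h : nat) (a : form) : form :=
  if (h < n)%N then fun p => orthproj (E0 h.+1) (ext_d a p)
  else if h == n then ext_d (rumin_lift a (rumin_beta a))
  else ext_d a.

Definition section_of (m : nat) (xi : m.-tuple covec) (a : 'I_m -> H -> R) :
    form := fun p => \sum_(J < m) a J p *: tnth xi J.

End Heisenberg.

(* Main.v *)
Require Import Defs.
From HB Require Import structures.
From mathcomp Require Import all_boot all_order all_algebra.
From mathcomp Require Import all_classical all_reals all_analysis.
From mathcomp Require Import ess_sup_inf hoelder.
From mathcomp Require Import zify ring.

Set Implicit Arguments.
Unset Strict Implicit.
Unset Printing Implicit Defensive.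

Import Order.TTheory GRing.Theory Num.Theory.
Import numFieldNormedType.Exports.

Local Open Scope ring_scope.

(** The components of [d_c a] on a basis of E_0^(h+1) are scalar equations
    sum W_i (A_i a)_I = 0, or sum W_i W_j (A_ij a)_I = 0 in the middle degree,
    where the A's are constant linear maps: the symbol of d_c.  Taking for G_I
    the components (A_i a)_I gives the divergence equations for free, and the
    pointwise linearity of a |-> G_I gives the L^p bounds.  What has to be proved
    is that a can be recovered linearly from the G_I, that is, that a covector u
    in E_0^h killed by all the A_i vanishes [recover_coefficients].  This is
    algebra in the exterior algebra, where omega_i /\ and the contractions with
    the dual basis satisfy the canonical anticommutation relations [extC], [ctrC],
    [ctr_ext]; L and Lambda then form an sl(2) pair [Lambda_Lop].

    - For h > n, E_0^h consists of the b /\ theta with L b = 0, and A_i is the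
      product with omega_i; a horizontal b with omega_i /\ b = 0 for all i is zero
      unless it has top degree 2n, which h <= 2n excludes [symbol_high_inj].
    - For h < n, A_i is omega_i /\ followed by the projection on E_0^(h+1).  If u is
      primitive (Lambda u = 0), the primitive part of omega_i /\ u is
      omega_i /\ u - c L (C_i u), with C_i = [Lambda, omega_i /\] and
      c = 1 / (n - h + 1).  If it is zero for every i, contracting with the i-th
      vector and summing gives (2n - h) u = c h u, so u = 0
      [primitive_ext_inj].
    - For h = n the same formula has no primitive part left: omega_i /\ u =
      L (C_i u).  So Rumin's correction is explicit, beta = -+ sum C_i (W_i a),
      and d_c a = theta /\ (T a + sum omega_i /\ C_j (W_i W_j a)) [dc_middle].
      Writing T = [X_1, Y_1] turns this into a second-order expression, in which
      T only contributes to the antisymmetric part of the coefficients.  The symmetric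
      part vanishes on u when omega_i /\ C_j u + omega_j /\ C_i u = 0 for all
      i and j; contracting with the i-th vector and summing gives
      (n + 2) C_j u = 0, whence u = 0 [primitive_middle_inj].

    On the analytic side, [ext_dE] computes the exterior derivative in the
    left-invariant coframe, and [derive_comm] is the symmetry of second
    derivatives on which [X_1, Y_1] = T rests. *)

(** * L^p norms *)

Section Norms.
Local Open Scope ereal_scope.
Context d (T : measurableType d) (R : realType).
Variable mu : {measure set T -> \bar R}.

Import HBNNSimple.

(** Stated without measurability: the integral of a nonnegative function is a
    supremum over the simple functions below it, and these can be rescaled. *)
Lemma integral_le_scale (F G : T -> \bar R) (k : R) : (0 < k)%R ->
  (forall x, 0 <= F x) -> (forall x, 0 <= G x) ->
  (forall x, F x <= k%:E * G x) ->
  \int[mu]_x F x <= k%:E * \int[mu]_x G x.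
Proof.
move=> k_gt0 F_ge0 G_ge0 FG.
have kV_ge0 : (0 <= k^-1)%R by rewrite invr_ge0 ltW.
rewrite !ge0_integralTE//.
apply: ge_ereal_sup => _ [h hF <-].
rewrite -lee_pdivrMl//.
apply: ereal_sup_ubound => /=.
exists (scale_nnsfun h kV_ge0); last exact: sintegralrM.
move=> x /=; rewrite EFinM lee_pdivrMl//.
exact: le_trans (hF x) (FG x).
Qed.

Lemma Lnorm_le_scale (q : \bar R) (f g : T -> R) (C : R) : 1 <= q -> (0 < C)%R ->
  (forall x, `|f x| <= C * `|g x|)%R ->
  Lnorm mu q (EFin \o f) <= C%:E * Lnorm mu q (EFin \o g).
Proof.
move=> q_ge1 C_gt0 fg; rewrite unlock; case: q q_ge1 => [q| |]//; last first.
  move=> _; case: ifPn => [mu_gt0|_]; last by rewrite mule0.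
  rewrite -ess_sup_pZl//; apply: le_ess_sup; apply: nearW => x /=.
  by rewrite lee_fin.
rewrite lee_fin => q_ge1.
have q_gt0 : (0 < q)%R by exact: lt_le_trans q_ge1.
have H : (forall x, `|(f x)%:E| `^ q <= (C `^ q)%:E * `|(g x)%:E| `^ q) ->
    \int[mu]_x `|(f x)%:E| `^ q <= (C `^ q)%:E * \int[mu]_x `|(g x)%:E| `^ q.
  apply: integral_le_scale; first exact: powR_gt0.
  - by move=> x; rewrite poweR_ge0.
  - by move=> x; rewrite poweR_ge0.
have int_ge0 (h : T -> R) : 0 <= \int[mu]_x `|(EFin \o h) x| `^ q.
  by apply: integral_ge0 => x _; rewrite poweR_ge0.
have CE : C = ((C `^ q) `^ q^-1)%R by rewrite -powRrM mulfV ?gt_eqF// powRr1 ?ltW.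
rewrite [in leRHS]CE -poweR_EFin -poweRM ?lee_fin ?powR_ge0//.
apply: gt0_ler_poweR; first by rewrite invr_ge0 ltW.
- by rewrite in_itv /= leey andbT int_ge0.
- by rewrite in_itv /= leey andbT mule_ge0 ?lee_fin ?powR_ge0 ?int_ge0.
apply: H => x; rewrite -poweR_EFin -poweRM ?lee_fin ?(ltW C_gt0)//.
by apply: ge0_ler_powR; rewrite ?nnegrE ?mulr_ge0// ltW.
Qed.

End Norms.

Lemma sqrt_sum_sqr_le_sum_norm (R : realType) (I : finType) (F : I -> R) :
  Num.sqrt (\sum_i F i ^+ 2) <= \sum_i `|F i|.
Proof.
have S_ge0 : 0 <= \sum_i `|F i| by exact: sumr_ge0.
rewrite -(ger0_norm S_ge0) -sqrtr_sqr ler_wsqrtr// expr2 mulr_suml.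
apply: ler_sum => i _; rewrite -(real_normK (num_real _)) expr2 ler_wpM2l//.
by rewrite (bigD1 i)//= lerDl sumr_ge0.
Qed.

Lemma norm_le_sqrt_sum_sqr (R : realType) (I : finType) (F : I -> R) i :
  `|F i| <= Num.sqrt (\sum_i F i ^+ 2).
Proof.
rewrite -sqrtr_sqr ler_wsqrtr// (bigD1 i)//= lerDl.
by apply: sumr_ge0 => j _; exact: sqr_ge0.
Qed.

(** The norms are those of the Euclidean lengths of the families, and the bound
    is pointwise; the constant serves all the families indexed by I at once. *)
Lemma Lpnorm_lincomb_le (R : realType) (N : nat) (I K J : finType)
    (m : I -> K -> J -> R) :
  exists2 C : R, 0 < C & forall (a : J -> 'rV[R]_N -> R) i (q : \bar R),
    (1 <= q)%E ->
    (Lpnorm q (fun k p => \sum_j m i k j * a j p)%R <= C%:E * Lpnorm q a)%E.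
Proof.
have M_ge0 i : 0 <= \sum_k \sum_j `|m i k j|.
  by apply: sumr_ge0 => k _; exact: sumr_ge0.
have C_ge0 : 0 <= \sum_i \sum_k \sum_j `|m i k j| by exact: sumr_ge0.
exists (1 + \sum_i \sum_k \sum_j `|m i k j|); first by rewrite ltr_pwDl.
move=> a i q q_ge1; apply: Lnorm_le_scale => // [|z]; first by rewrite ltr_pwDl.
rewrite !ger0_norm ?sqrtr_ge0//; apply: le_trans (sqrt_sum_sqr_le_sum_norm _) _.
set r := Num.sqrt (\sum_j _ ^+ 2).
apply: (@le_trans _ _ ((\sum_k \sum_j `|m i k j|) * r)).
  rewrite mulr_suml; apply: ler_sum => k _; rewrite mulr_suml.
  apply: le_trans (ler_norm_sum _ _ _) _; apply: ler_sum => j _.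
  by rewrite normrM ler_wpM2l// (norm_le_sqrt_sum_sqr (fun j => a j (space_row z))).
rewrite ler_wpM2r ?sqrtr_ge0// (bigD1 i)//= addrCA lerDl addr_ge0//.
exact: sumr_ge0.
Qed.

(** * Symmetry of second derivatives *)

Section Calculus.
Variables (R : realType) (V : normedModType R).
Implicit Types (f g : V -> R) (p q u v : V).

Lemma is_derive_line f q u (s : R) : differentiable f (q + s *: u) ->
  is_derive s 1 (fun r : R => f (q + r *: u)) ('D_u f (q + s *: u)).
Proof.
move=> /(@diff_derivable _ _ _ _ _ u) df.
have E : (fun h : R => h^-1 *: (((fun r : R => f (q + r *: u)) \o shift s) (h *: 1)
            - f (q + s *: u))) =
         (fun h : R => h^-1 *: ((f \o shift (q + s *: u)) (h *: u) - f (q + s *: u))).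
  apply/funext => h /=; congr (_ *: (f _ - _)).
  by rewrite scalerDl addrCA [h *: 1]mulr1.
split; first by rewrite /derivable E; exact: df.
by rewrite /derive E.
Qed.

(** The mean value theorem, applied first along u to the increment of f along
    v, then along v to the derivative of f along u. *)
Lemma mixed_difference f p u v (h : R) : 0 < h ->
  (forall q, differentiable f q) -> (forall q, differentiable ('D_u f) q) ->
  exists2 st : R * R, 0 < st.1 < h /\ 0 < st.2 < h &
    f (p + h *: v + h *: u) - f (p + h *: u) - (f (p + h *: v) - f p) =
    'D_v ('D_u f) (p + st.1 *: u + st.2 *: v) * h * h.
Proof.
move=> h0 df ddf.
pose phi (s : R) := f (p + h *: v + s *: u) - f (p + s *: u).
pose dphi (s : R) := 'D_u f (p + h *: v + s *: u) - 'D_u f (p + s *: u).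
have dphiP (s : R) : is_derive s (1 : R) phi (dphi s).
  by apply: is_deriveB; exact: is_derive_line.
have [s sh phiE] : exists2 s, s \in `]0, h[ & phi h - phi 0 = dphi s * (h - 0).
  apply: MVT => //; apply: derivable_within_continuous => x _.
  exact: ex_derive.
pose psi (t : R) := 'D_u f (p + s *: u + t *: v).
pose dpsi (t : R) := 'D_v ('D_u f) (p + s *: u + t *: v).
have dpsiP (t : R) : is_derive t (1 : R) psi (dpsi t) by exact: is_derive_line.
have [t th psiE] : exists2 t, t \in `]0, h[ & psi h - psi 0 = dpsi t * (h - 0).
  apply: MVT => [//|]; apply: derivable_within_continuous => x _.
  exact: ex_derive.
exists (s, t); first by move: sh th; rewrite !in_itv.
move: phiE psiE; rewrite /phi /dphi /psi /dpsi !scale0r !addr0 !subr0 => -> .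
by rewrite [p + h *: v + _]addrAC => ->.
Qed.

(** The mixed second difference is symmetric in u and v, so by
    [mixed_difference] the two mixed derivatives take a common value, each at
    some point as close to p as desired. *)
Lemma derive_comm f p u v :
  (forall q, differentiable f q) ->
  (forall q, differentiable ('D_u f) q) -> (forall q, differentiable ('D_v f) q) ->
  {for p, continuous ('D_v ('D_u f))} -> {for p, continuous ('D_u ('D_v f))} ->
  'D_v ('D_u f) p = 'D_u ('D_v f) p.
Proof.
move=> df duf dvf cvu cuv; apply/eqP/negPn/negP => neq.
pose e := `|'D_v ('D_u f) p - 'D_u ('D_v f) p| / 2.
have e0 : 0 < e by rewrite divr_gt0// normr_gt0 subr_eq0.
have /cvgrPdist_lt/(_ e e0)/nbhs_ballP[d1 /= d1_gt0 H1] := cvu.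
have /cvgrPdist_lt/(_ e e0)/nbhs_ballP[d2 /= d2_gt0 H2] := cuv.
pose d := Num.min d1 d2.
have d_gt0 : 0 < d by rewrite lt_min d1_gt0.
pose K := 1 + `|u| + `|v|.
have K_gt0 : 0 < K by rewrite /K -addrA ltr_pwDl// addr_ge0.
pose h := d / K; have h_gt0 : 0 < h by rewrite divr_gt0.
have near_p w1 w2 (s t : R) : 0 < s < h -> 0 < t < h -> `|w1| + `|w2| < K ->
    `|p - (p + s *: w1 + t *: w2)| < d.
  move=> /andP[s0 sh] /andP[t0 th] wK.
  rewrite -addrA opprD addNKr normrN (le_lt_trans (ler_normD _ _))// !normrZ.
  rewrite !gtr0_norm//.
  rewrite (@le_lt_trans _ _ (h * (`|w1| + `|w2|)))//.
    by rewrite mulrDr lerD// ler_wpM2r// ltW.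
  by rewrite -(ltr_pdivlMl _ _ h_gt0) /h invf_div divfK ?gt_eqF.
have [[s t] /= [sh th] E1] := mixed_difference p v h_gt0 df duf.
have [[s' t'] /= [sh' th'] E2] := mixed_difference p u h_gt0 df dvf.
have uvK : `|u| + `|v| < K by rewrite /K -addrA ltrDr.
have vuK : `|v| + `|u| < K by rewrite addrC.
have D1 : `|'D_v ('D_u f) p - 'D_v ('D_u f) (p + s *: u + t *: v)| < e.
  apply: H1; rewrite -ball_normE /=.
  by apply: lt_le_trans (near_p _ _ _ _ sh th uvK) _; rewrite ge_min lexx.
have D2 : `|'D_u ('D_v f) p - 'D_u ('D_v f) (p + s' *: v + t' *: u)| < e.
  apply: H2; rewrite -ball_normE /=.
  by apply: lt_le_trans (near_p _ _ _ _ sh' th' vuK) _; rewrite ge_min lexx orbT.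
have E3 : 'D_v ('D_u f) (p + s *: u + t *: v) = 'D_u ('D_v f) (p + s' *: v + t' *: u).
  apply: (mulIf (lt0r_neq0 h_gt0)); apply: (mulIf (lt0r_neq0 h_gt0)).
  have swap (a b c x : R) : a - b - (c - x) = a - c - (b - x).
    by rewrite !opprB addrACA [RHS]addrACA [- b + _]addrC.
  apply: etrans (esym E1) (etrans _ E2); rewrite (addrAC p (h *: v)).
  exact: swap.
rewrite E3 in D1.
have tri (x y z : R) : `|x - y| <= `|x - z| + `|y - z|.
  by rewrite [`|y - z|]distrC; exact: ler_distD.
have := le_lt_trans (tri _ _ _) (ltrD D1 D2).
by rewrite -splitr ltxx.
Qed.

End Calculus.

(** * Smooth functions and the fields W_i *)

Section Smooth.
Variables (R : realType) (n : nat).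
Local Notation H := (Heis R n).
Local Notation idx := 'I_(n + n + 1).
Implicit Types (f g : H -> R) (p : H) (i : idx).

Lemma smooth_differentiable f p : smooth f -> differentiable f p.
Proof. by move=> /(_ [::]). Qed.

Lemma smooth_pd f i : smooth f -> smooth (pd i f).
Proof. by move=> fs s p; rewrite -foldr_rcons. Qed.

(** Smoothness is the greatest property that implies differentiability and is
    inherited by the partial derivatives; the closure properties below follow
    by exhibiting such properties. *)
Lemma smooth_coind (P : (H -> R) -> Prop) :
  (forall f p, P f -> differentiable f p) -> (forall f i, P f -> P (pd i f)) ->
  forall f, P f -> smooth f.
Proof.
move=> Pd Ppd f Pf s; suff: P (foldr (@pd R n) f s) by move=> + p => /Pd.
by elim: s => //= i s; exact: Ppd.
Qed.

Lemma pdE f i p : pd i f p = 'D_(delta_mx 0 i) f p. Proof. by []. Qed.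

Lemma pd_cst i (c : R) : @pd R n i (fun=> c) = fun=> 0.
Proof. by apply/funext => p; exact: derive_cst. Qed.

Lemma pdD f g i p : differentiable f p -> differentiable g p ->
  pd i (fun q => f q + g q) p = pd i f p + pd i g p.
Proof. by move=> fp gp; apply: deriveD; exact: diff_derivable. Qed.

Lemma pdM f g i p : differentiable f p -> differentiable g p ->
  pd i (fun q => f q * g q) p = f p * pd i g p + g p * pd i f p.
Proof.
move=> fp gp; have := @deriveM _ _ f g p (delta_mx 0 i).
by apply; exact: diff_derivable.
Qed.

Lemma pdMl (c : R) f i p : differentiable f p ->
  pd i (fun q => c * f q) p = c * pd i f p.
Proof.
move=> fp; rewrite (@pdM (fun=> c))//.
by rewrite pd_cst mulr0 addr0.
Qed.

Lemma smooth_cst (c : R) : smooth (fun _ : H => c).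
Proof.
apply: (@smooth_coind (fun f => exists c, f = fun=> c)); last by exists c.
  by move=> _ p [a ->]; exact: differentiable_cst.
by move=> _ i [a ->]; exists 0; exact: pd_cst.
Qed.

Lemma pd_coord i (k : idx) : pd i (fun q : H => q 0 k) = fun=> (k == i)%:R.
Proof.
apply/funext => p; rewrite pdE deriveE; last exact: differentiable_coord.
have L : linear (fun q : H => q 0 k : R) by move=> a u v; rewrite !mxE.
pose lM := GRing.isLinear.Build _ _ _ _ _ L.
pose l : {linear H -> R} := HB.pack (fun q : H => q 0 k : R) lM.
rewrite (_ : (fun q : H => q 0 k) = l :> (H -> R))// diff_lin.
  by rewrite /= mxE eqxx.
exact: coord_continuous.
Qed.

Lemma smooth_coord (k : idx) : smooth (fun q : H => q 0 k).
Proof.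
apply: (@smooth_coind (fun f => f = (fun q : H => q 0 k) \/ smooth f)); last by left.
  by move=> f p [->|/smooth_differentiable//]; exact: differentiable_coord.
move=> f i [->|fs]; right; last exact: smooth_pd.
by rewrite pd_coord; exact: smooth_cst.
Qed.

(** Closing the smooth functions under sums and products before applying
    [smooth_coind] absorbs the terms that the Leibniz rule produces. *)
Inductive smooth_algebra : (H -> R) -> Prop :=
| SmoothGen f of smooth f : smooth_algebra f
| SmoothAdd f g of smooth_algebra f & smooth_algebra g :
    smooth_algebra (fun p => f p + g p)
| SmoothMul f g of smooth_algebra f & smooth_algebra g :
    smooth_algebra (fun p => f p * g p).

Lemma smooth_algebraP f : smooth_algebra f -> smooth f.
Proof.
have D g p : smooth_algebra g -> differentiable g p.
  elim=> [{}g gs|{}g h _ gp _ hp|{}g h _ gp _ hp].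
  - exact: smooth_differentiable.
  - exact: differentiableD.
  - exact: differentiableM.
apply: smooth_coind => // {}f i; elim=> [g gs|g h gs dg hs dh|g h gs dg hs dh].
- by apply: SmoothGen; exact: smooth_pd.
- rewrite (_ : pd i _ = fun p => pd i g p + pd i h p); first exact: SmoothAdd.
  by apply/funext => p; apply: pdD; exact: D.
- rewrite (_ : pd i _ = fun p => g p * pd i h p + h p * pd i g p).
    by apply: SmoothAdd; exact: SmoothMul.
  by apply/funext => p; apply: pdM; exact: D.
Qed.

Lemma smoothD f g : smooth f -> smooth g -> smooth (fun p => f p + g p).
Proof. by move=> ? ?; apply: smooth_algebraP; apply: SmoothAdd; exact: SmoothGen. Qed.

Lemma smoothM f g : smooth f -> smooth g -> smooth (fun p => f p * g p).
Proof. by move=> ? ?; apply: smooth_algebraP; apply: SmoothMul; exact: SmoothGen. Qed.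

Lemma smoothMl (c : R) f : smooth f -> smooth (fun p => c * f p).
Proof. by move=> fs; apply: smoothM => //; exact: smooth_cst. Qed.

Lemma smooth_sum (I : Type) (r : seq I) (P : pred I) (F : I -> H -> R) :
  (forall k, smooth (F k)) -> smooth (fun p => \sum_(k <- r | P k) F k p).
Proof.
move=> Fs; elim: r => [|k r IH].
  by under eq_fun do rewrite big_nil; exact: smooth_cst.
under eq_fun do rewrite big_cons; case: (P k) => //.
exact: smoothD.
Qed.

Lemma pd_sum (I : Type) (r : seq I) (P : pred I) (F : I -> H -> R) i p :
  (forall k, smooth (F k)) ->
  pd i (fun q => \sum_(k <- r | P k) F k q) p = \sum_(k <- r | P k) pd i (F k) p.
Proof.
move=> Fs; elim: r => [|k r IH].
  by under eq_fun do rewrite big_nil; rewrite pd_cst big_nil.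
under eq_fun do rewrite big_cons; rewrite big_cons; case: (P k) => //.
by rewrite pdD ?IH//; apply: smooth_differentiable => //; exact: smooth_sum.
Qed.

Lemma pd_comm f i (j : idx) p : smooth f -> pd i (pd j f) p = pd j (pd i f) p.
Proof.
move=> fs; apply: derive_comm.
- by move=> q; exact: smooth_differentiable.
- by move=> q; apply: smooth_differentiable; exact: smooth_pd.
- by move=> q; apply: smooth_differentiable; exact: smooth_pd.
- by apply: differentiable_continuous; apply: smooth_differentiable; do 2!apply: smooth_pd.
- by apply: differentiable_continuous; apply: smooth_differentiable; do 2!apply: smooth_pd.
Qed.

(** The coefficient of d/dt in W_i. *)
Definition Wcoef (i : 'I_(n + n)) (p : H) : R :=
  match fintype.split i with
  | inl j => - (2^-1 * p 0 (iy j))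
  | inr j => 2^-1 * p 0 (ix j)
  end.

Lemma WE (i : 'I_(n + n)) f p : W i f p = pd (lshift 1 i) f p + Wcoef i p * pd (it n) f p.
Proof.
rewrite /W /Wcoef -{2}(splitK i) /unsplit /ix /iy.
by case: (fintype.split i) => j; rewrite ?mulNr.
Qed.

Lemma smooth_Wcoef (i : 'I_(n + n)) : smooth (Wcoef i).
Proof.
rewrite /Wcoef; case: (fintype.split i) => j; last first.
  by apply: smoothMl; exact: smooth_coord.
under eq_fun do rewrite -mulNr.
by apply: smoothMl; exact: smooth_coord.
Qed.

Lemma smooth_W (i : 'I_(n + n)) f : smooth f -> smooth (W i f).
Proof.
move=> fs; rewrite (_ : W i f = fun p => pd (lshift 1 i) f p + Wcoef i p * pd (it n) f p).
  apply: smoothD; first exact: smooth_pd.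
  by apply: smoothM; [exact: smooth_Wcoef|exact: smooth_pd].
by apply/funext => p; exact: WE.
Qed.

Lemma W_lincomb (I : finType) (c : I -> R) (F : I -> H -> R) (i : 'I_(n + n)) p :
  (forall k, smooth (F k)) ->
  W i (fun q => \sum_k c k * F k q) p = \sum_k c k * W i (F k) p.
Proof.
move=> Fs; have cF k : smooth (fun q => c k * F k q) by exact: smoothMl.
rewrite WE !pd_sum// mulr_sumr -big_split /=; apply: eq_bigr => k _.
by rewrite !pdMl ?WE ?mulrDr ?[_ * (c k * _)]mulrCA//; exact: smooth_differentiable.
Qed.

(** [X_j, Y_j] = T. *)
Lemma W_commutator (j : 'I_n) f p : smooth f ->
  W (lshift n j) (W (rshift n j) f) p - W (rshift n j) (W (lshift n j) f) p =
  pd (it n) f p.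
Proof.
move=> fs.
have WEf (i : 'I_(n + n)) : W i f = fun p => pd (lshift 1 i) f p + Wcoef i p * pd (it n) f p.
  by apply/funext => q; exact: WE.
have Wl q : Wcoef (lshift n j) q = - (2^-1 * q 0 (iy j)) by rewrite /Wcoef (unsplitK (inl _)).
have Wr q : Wcoef (rshift n j) q = 2^-1 * q 0 (ix j) by rewrite /Wcoef (unsplitK (inr _)).
have D (k : idx) (l : 'I_(n + n)) : pd k (fun p => pd (lshift 1 l) f p + Wcoef l p * pd (it n) f p) p =
    pd k (pd (lshift 1 l) f) p + (Wcoef l p * pd k (pd (it n) f) p + pd (it n) f p * pd k (Wcoef l) p).
  rewrite pdD ?pdM//; apply: smooth_differentiable; try exact: smooth_pd.
  - exact: smooth_Wcoef.
  - by apply: smoothM; [exact: smooth_Wcoef|exact: smooth_pd].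
have dWl (k : idx) : pd k (Wcoef (lshift n j)) p = - 2^-1 * (iy j == k)%:R.
  rewrite (_ : Wcoef _ = fun q => - 2^-1 * q 0 (iy j)); last first.
    by apply/funext => q; rewrite Wl mulNr.
  by rewrite pdMl ?pd_coord//; exact: differentiable_coord.
have dWr (k : idx) : pd k (Wcoef (rshift n j)) p = 2^-1 * (ix j == k)%:R.
  rewrite (_ : Wcoef _ = fun q => 2^-1 * q 0 (ix j)); last by apply/funext => q; rewrite Wr.
  by rewrite pdMl ?pd_coord//; exact: differentiable_coord.
rewrite !WEf !WE !D !dWl !dWr.
have -> : (iy j == it n) = false by rewrite eq_lrshift.
have -> : (ix j == it n) = false by rewrite eq_lrshift.
rewrite /ix /iy !eqxx; set x := lshift 1 (lshift n j); set y := lshift 1 (rshift n j).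
have Exy := pd_comm x y p fs; have Ext := pd_comm x (it n) p fs.
have Eyt := pd_comm y (it n) p fs.
move: (Wcoef (lshift n j) p) (Wcoef (rshift n j) p) Exy Ext Eyt => wx wy.
by move: (@pd R n) => D' -> -> ->; rewrite /= mulr1n mulr0n; field.
Qed.

End Smooth.

(** * Exterior products and contractions *)

Section ExteriorAlgebra.
Variables (R : realType) (n : nat).
Local Notation idx := 'I_(n + n + 1).
Local Notation V := (covec R n).
Implicit Types (i j : idx) (S T U : {set idx}) (u v w : V).

(** The sign produced by moving the i-th basis covector to its place in the
    monomial indexed by S. *)
Definition sg i S : R := (-1) ^+ #|[set j in S | (j < i)%N]%SET|.

Lemma sgM i S : sg i S * sg i S = 1.
Proof. by rewrite -expr2 -exprM mulnC exprM sqrrN !expr1n. Qed.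

Lemma sign_lt i j : i != j -> (-1) ^+ (i < j)%N = - (-1) ^+ (j < i)%N :> R.
Proof.
move=> ij; case: (ltngtP i j) => [| |/val_inj E]; rewrite ?expr0 ?expr1 ?opprK//.
by rewrite E eqxx in ij.
Qed.

Lemma sgD1 i j S : j \in S -> sg i S = (-1) ^+ (j < i)%N * sg i (S :\ j)%SET.
Proof.
move=> jS; rewrite /sg -exprD; congr (_ ^+ _).
rewrite (cardsD1 j) inE jS /=; congr (_ + _)%N.
by apply: eq_card => k; rewrite !inE andbA.
Qed.

Lemma sgU i S T : [disjoint S & T] -> sg i (S :|: T)%SET = sg i S * sg i T.
Proof.
move=> dST; rewrite /sg -exprD -cardsUI.
set A := (_ :&: _)%SET; have -> : A = finset.set0.
  apply/setP => k; rewrite !inE; apply/negbTE/negP => /andP[/andP[kS _] /andP[kT _]].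
  by move: dST => /finset.disjoint_setI0/setP/(_ k); rewrite !inE kS kT.
by rewrite cards0 addn0; congr (_ ^+ _); apply: eq_card => k; rewrite !inE andb_orl.
Qed.

Definition ext i u : V := wedge (mono R [set i]%SET) u.
Definition ctr i u : V := adjoint (ext i) u.

HB.instance Definition _ i := GRing.Linear.copy (ext i) (wedge (mono R [set i]%SET)).
HB.instance Definition _ i := GRing.Linear.copy (ctr i) (adjoint (ext i)).

Lemma ext0r i : ext i 0 = 0. Proof. exact: (linear0 (ext i)). Qed.
Lemma extDr i u v : ext i (u + v) = ext i u + ext i v.
Proof. exact: (linearD (ext i)). Qed.
Lemma extNr i u : ext i (- u) = - ext i u. Proof. exact: (linearN (ext i)). Qed.
Lemma extBr i u v : ext i (u - v) = ext i u - ext i v.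
Proof. exact: (linearB (ext i)). Qed.
Lemma extZr i (a : R) u : ext i (a *: u) = a *: ext i u.
Proof. by rewrite linearZ. Qed.
Lemma ext_sumr i (I : Type) (r : seq I) (P : pred I) (F : I -> V) :
  ext i (\sum_(k <- r | P k) F k) = \sum_(k <- r | P k) ext i (F k).
Proof. exact: (linear_sum (ext i)). Qed.

Lemma ctr0r i : ctr i 0 = 0. Proof. exact: (linear0 (ctr i)). Qed.
Lemma ctrDr i u v : ctr i (u + v) = ctr i u + ctr i v.
Proof. exact: (linearD (ctr i)). Qed.
Lemma ctrNr i u : ctr i (- u) = - ctr i u. Proof. exact: (linearN (ctr i)). Qed.
Lemma ctrBr i u v : ctr i (u - v) = ctr i u - ctr i v.
Proof. exact: (linearB (ctr i)). Qed.
Lemma ctrZr i (a : R) u : ctr i (a *: u) = a *: ctr i u.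
Proof. by rewrite linearZ. Qed.
Lemma ctr_sumr i (I : Type) (r : seq I) (P : pred I) (F : I -> V) :
  ctr i (\sum_(k <- r | P k) F k) = \sum_(k <- r | P k) ctr i (F k).
Proof. exact: (linear_sum (ctr i)). Qed.

Lemma extE i u U : ext i u U = if i \in U then sg i (U :\ i)%SET * u (U :\ i)%SET else 0.
Proof.
rewrite /ext ffunE; case: ifPn => iU; last first.
  apply: big1 => S SU; rewrite ffunE (_ : (S == _) = false) ?mulr0 ?mul0r//.
  by apply: contraNF iU => /eqP SE; move: SU; rewrite SE finset.sub1set.
rewrite (bigD1 [set i]%SET) ?finset.sub1set//= ffunE eqxx mulr1 big1 ?addr0; last first.
  by move=> S /andP[_ Si]; rewrite ffunE (negbTE Si) mulr0 mul0r.
congr (_ * _); rewrite /wedge_sign /sg; congr (_ ^+ _).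
rewrite -(card_imset _ (_ : injective (fun j => (i, j)))) => [|j k []//].
apply: eq_card => -[k l]; rewrite !inE /=; apply/idP/imsetP.
  by move=> /andP[/andP[/eqP-> li] lt]; exists l => //; rewrite !inE li.
by move=> [m]; rewrite !inE => /andP[mU mi] [-> ->]; rewrite eqxx mU mi.
Qed.

Lemma ctrE i u S : ctr i u S = if i \in S then 0 else sg i S * u (i |: S)%SET.
Proof.
rewrite /ctr ffunE /dot; case: ifPn => iS.
  apply: big1 => U _; rewrite extE; case: ifP => iU; last by rewrite mul0r.
  rewrite ffunE (_ : (_ == S) = false) ?mulr0 ?mul0r//.
  by apply: contraTF iS => /eqP <-; rewrite !inE eqxx.
rewrite (bigD1 (i |: S)%SET)//= extE finset.setU11 finset.setU1K// ffunE eqxx mulr1.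
rewrite big1 ?addr0// => U UiS; rewrite extE; case: ifP => iU; last by rewrite mul0r.
rewrite ffunE (_ : (_ == S) = false) ?mulr0 ?mul0r//.
by apply: contraNF UiS => /eqP <-; rewrite finset.setD1K.
Qed.

Lemma covecDE u v S : (u + v) S = u S + v S. Proof. by rewrite ffunE. Qed.
Lemma covecNE u S : (- u) S = - u S. Proof. by rewrite ffunE. Qed.
Lemma covecZE (a : R) u S : (a *: u) S = a * u S. Proof. by rewrite ffunE. Qed.
Lemma covec0E S : (0 : V) S = 0. Proof. by rewrite ffunE. Qed.

Lemma dot0r u : dot u 0 = 0. Proof. exact: (linear0 (dot u)). Qed.
Lemma dotDr u v w : dot u (v + w) = dot u v + dot u w.
Proof. exact: (linearD (dot u)). Qed.
Lemma dotNr u v : dot u (- v) = - dot u v. Proof. exact: (linearN (dot u)). Qed.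
Lemma dotZr u (a : R) v : dot u (a *: v) = a * dot u v.
Proof. by rewrite /dot mulr_sumr; apply: eq_bigr => S _; rewrite covecZE mulrCA. Qed.
Lemma dot_sumr (I : Type) (r : seq I) (P : pred I) (F : I -> V) u :
  dot u (\sum_(k <- r | P k) F k) = \sum_(k <- r | P k) dot u (F k).
Proof. exact: (linear_sum (dot u)). Qed.

Lemma dot_ext i u v : dot (ext i u) v = dot u (ctr i v).
Proof. exact: adjointP. Qed.

Lemma dot_ctr i u v : dot (ctr i u) v = dot u (ext i v).
Proof. by rewrite dotC -dot_ext dotC. Qed.

Lemma dot_inj v w : (forall u, dot u v = dot u w) -> v = w.
Proof.
move=> H; apply/ffunP => S; have := H (mono R S).
by rewrite dotC dot_mono dotC dot_mono.
Qed.

Lemma dot_self_eq0 v : dot v v = 0 -> v = 0.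
Proof.
move=> /eqP; rewrite /dot psumr_eq0 => [/allP H|S _]; last exact: sqr_ge0.
apply/ffunP => S; rewrite ffunE; apply/eqP.
by have := H S; rewrite mem_index_enum mulf_eq0 orbb; exact.
Qed.

Lemma dot_self_ge0 v : 0 <= dot v v.
Proof. by apply: sumr_ge0 => S _; exact: sqr_ge0. Qed.

Lemma extC i j u : ext i (ext j u) = - ext j (ext i u).
Proof.
apply/ffunP => U; rewrite covecNE !extE !inE; have [->|ij] := eqVneq i j.
  by case: ifP; rewrite ?mulr0 ?oppr0.
rewrite /=; case: ifPn => iU; case: ifPn => jU; rewrite ?mulr0 ?oppr0//.
have jUi : j \in (U :\ i)%SET by rewrite !inE eq_sym ij.
have iUj : i \in (U :\ j)%SET by rewrite !inE ij.
rewrite (sgD1 i jUi) (sgD1 j iUj).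
have -> : (U :\ j :\ i = U :\ i :\ j)%SET by apply/setP => k; rewrite !inE andbCA.
have -> : (-1) ^+ (i < j)%N = - (-1) ^+ (j < i)%N :> R.
  exact: sign_lt.
by ring.
Qed.

Lemma ext_sqr i u : ext i (ext i u) = 0.
Proof. by apply/ffunP => U; rewrite !extE covec0E !inE eqxx; case: ifP => //; rewrite mulr0. Qed.

Lemma ctrC i j u : ctr i (ctr j u) = - ctr j (ctr i u).
Proof.
apply: dot_inj => v; rewrite linearN /= -!dot_ext extC.
by rewrite [LHS]dotC linearN /= dotC.
Qed.

(** With [extC] and [ctrC], these are the canonical anticommutation relations,
    from which the commutators of L and Lambda are computed. *)
Lemma ctr_ext i j u : ctr i (ext j u) = (i == j)%:R *: u - ext j (ctr i u).
Proof.
apply/ffunP => S; rewrite covecDE covecNE covecZE ctrE !extE !inE.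
have [<-|ij] := eqVneq i j.
  rewrite mul1r; case: ifPn => iS.
    rewrite ctrE !inE eqxx /= finset.setD1K// mulrA sgM mul1r.
    by rewrite addrN.
  by rewrite subr0 finset.setU1K// mulrA sgM mul1r.
rewrite mul0r sub0r ctrE !inE (negbTE ij) /=.
case: ifPn => iS; case: ifPn => jS; rewrite ?mulr0 ?oppr0//.
have -> : ((i |: S) :\ j = i |: (S :\ j))%SET.
  apply/setP => k; rewrite !inE; have [->|//] := eqVneq k j.
  by rewrite eq_sym (negbTE ij).
rewrite (sgD1 i jS).
rewrite (sgD1 (S := (i |: S :\ j)%SET) (j := i) j) ?finset.setU11// finset.setU1K ?inE ?(negbTE iS) ?andbF//.
have -> : (-1) ^+ (i < j)%N = - (-1) ^+ (j < i)%N :> R.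
  exact: sign_lt.
have := sgM i (S :\ j)%SET; have : (-1) ^+ (j < i)%N * (-1) ^+ (j < i)%N = 1 :> R.
  by rewrite -expr2 -exprM mulnC exprM sqrrN !expr1n.
move=> E1 _; transitivity (- ((-1) ^+ (j < i)%N * (-1) ^+ (j < i)%N) *
  (sg i (S :\ j)%SET * sg j (S :\ j)%SET * u (i |: S :\ j)%SET)); first by ring.
by rewrite E1; ring.
Qed.

Lemma wedge_signU1 i S T : i \notin S ->
  wedge_sign R (i |: S)%SET T = sg i T * wedge_sign R S T.
Proof.
move=> iS; rewrite /wedge_sign /sg -exprD; congr (_ ^+ _).
rewrite -(card_imset _ (_ : injective (fun j => (i, j)))) => [|j k []//].
rewrite -cardsUI; set A := (_ :&: _)%SET; have -> : A = finset.set0.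
  apply/setP => -[k l]; rewrite !inE /=; apply/negbTE/negP.
  by move=> /andP[/imsetP[m _ [-> _]]]; rewrite (negbTE iS).
rewrite cards0 addn0; apply: eq_card => -[k l]; rewrite !inE /=.
have [->|ki] := eqVneq k i.
  rewrite (negbTE iS) /= orbF; apply/idP/imsetP.
    by move=> /andP[lT li]; exists l => //; rewrite inE lT.
  by move=> [m]; rewrite !inE => /andP[mT mi] [->]; rewrite mT mi.
rewrite /=; case: imsetP => [[m _ []] ke|]//; by rewrite ke eqxx in ki.
Qed.

(** The case of the associativity of the wedge product that is needed to
    iterate products of 1-covectors. *)
Lemma wedge_ext i v w : wedge (ext i v) w = ext i (wedge v w).
Proof.
apply/ffunP => U; rewrite extE /wedge !ffunE.
rewrite (bigID (fun S => i \in S)) /= [X in _ + X]big1 ?addr0; last first.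
  by move=> S /andP[_ iS]; rewrite extE (negbTE iS) mulr0 mul0r.
case: ifPn => iU; last first.
  by apply: big1 => S /andP[/fintype.subsetP/(_ i) + iS]; rewrite iS (negbTE iU) => /(_ isT).
rewrite mulr_sumr (reindex_onto (fun S => i |: S)%SET (fun S => S :\ i)%SET) /=; last first.
  by move=> S /andP[_ iS]; rewrite finset.setD1K.
apply: eq_big => S.
  rewrite finset.setU11 andbT finset.subUset finset.sub1set iU /= finset.subsetD1.
  congr (_ && _); apply/eqP/idP => [<-|iS]; last exact: finset.setU1K.
  by rewrite !inE eqxx.
move=> /andP[/andP[SU _] /eqP SE].
have iS : i \notin S by rewrite -SE !inE eqxx.
have SU' : S \subset U by move: SU; rewrite finset.subUset => /andP[].
rewrite extE finset.setU11 SE.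
set T := (U :\: (i |: S))%SET.
have -> : (U :\ i :\: S = T)%SET by rewrite finset.setDDl.
have iT : i \notin T by rewrite !inE eqxx.
have -> : sg i (U :\ i)%SET = sg i S * sg i T.
  rewrite -sgU; last first.
    rewrite -finset.setI_eq0; apply/eqP/setP => k; rewrite !inE.
    by case: (k \in S); rewrite ?orbT ?andbF.
  congr sg; apply/setP => k; rewrite !inE.
  have [->|//] := eqVneq k i; first by rewrite (negbTE iS).
  by case: (boolP (k \in S)) => //= /(fintype.subsetP SU').
rewrite wedge_signU1//; by ring.
Qed.

End ExteriorAlgebra.

(** * The Lefschetz operators *)

Section Lefschetz.
Variables (R : realType) (n : nat).
Local Notation idx := 'I_(n + n + 1).
Local Notation V := (covec R n).
Local Notation L := (Lop R n).
Local Notation M := (Lambda R n).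
Local Notation t := (it n).
Implicit Types (i j : 'I_(n + n)) (S : {set idx}) (u v w : V).

Definition hor i : idx := lshift 1 i.

Lemma t_neq_hor i : (t == hor i) = false. Proof. exact: eq_rlshift. Qed.
Lemma hor_eq i j : (hor i == hor j) = (i == j). Proof. exact: eq_lshift. Qed.
Lemma ixy_eq (j k : 'I_n) :
  ((ix j == ix k) = (j == k)) * ((iy j == iy k) = (j == k)) *
  ((ix j == iy k) = false) * ((iy j == ix k) = false).
Proof. by rewrite !hor_eq eq_lshift eq_rshift eq_lrshift eq_rlshift. Qed.

Lemma sum_hor (F : 'I_(n + n) -> V) :
  \sum_i F i = \sum_(j < n) F (lshift n j) + \sum_(j < n) F (rshift n j).
Proof. exact: big_split_ord. Qed.

(** ** Horizontal covectors *)

Lemma hcovP k u : reflect (forall S, ~~ ((#|S| == k) && (t \notin S)) -> u S = 0)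
  (u \in hcov R n k).
Proof.
apply: (iffP idP) => [uk S SnK|uk].
  have /subvP/(_ u uk) : (hcov R n k <= lker (linfun (dot (mono R S) : V -> R^o)))%VS.
    apply/span_subvP => x /mapP[K]; rewrite mem_enum inE => Kk ->.
    rewrite memv_ker lfunE /= dot_mono ffunE.
    by rewrite (_ : (K == S) = false)//; apply: contraNF SnK => /eqP <-.
  by rewrite memv_ker lfunE /= dotC dot_mono => /eqP.
rewrite (covec_mono u); apply: memv_suml => S _.
have [Sk|/uk ->] := boolP ((#|S| == k) && (t \notin S)); last by rewrite scale0r mem0v.
by apply/memvZ/memv_span/map_f; rewrite mem_enum inE.
Qed.

Lemma ext_hcov i k u : u \in hcov R n k -> ext (hor i) u \in hcov R n k.+1.
Proof.
move=> /hcovP uk; apply/hcovP => S nS; rewrite extE; case: ifPn => // iS.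
rewrite uk ?mulr0//; apply: contra nS.
by rewrite [#|S|](cardsD1 (hor i)) iS !inE t_neq_hor /= eqSS.
Qed.

Lemma ctr_hcov i k u : u \in hcov R n k -> ctr (hor i) u \in hcov R n k.-1.
Proof.
move=> /hcovP uk; apply/hcovP => S nS; rewrite ctrE; case: ifPn => // iS.
rewrite uk ?mulr0//; apply: contra nS.
by rewrite cardsU1 iS !inE t_neq_hor /= => /andP[/eqP <- ->]; rewrite eqxx.
Qed.

Lemma ctr_t_hcov k u : u \in hcov R n k -> ctr t u = 0.
Proof.
move=> /hcovP uk; apply/ffunP => S; rewrite ctrE covec0E; case: ifPn => // tS.
by rewrite uk ?mulr0// !inE eqxx andbF.
Qed.

Lemma sum_ext_ctr k u : u \in hcov R n k ->
  \sum_i ext (hor i) (ctr (hor i) u) = k%:R *: u.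
Proof.
move=> /hcovP uk; apply/ffunP => S; rewrite covecZE sum_ffunE.
have [Sk|nS] := boolP ((#|S| == k) && (t \notin S)); last first.
  rewrite uk// mulr0 big1// => i _; rewrite extE; case: ifP => // iS.
  by rewrite ctrE !inE eqxx /= finset.setD1K// uk// !mulr0.
have {Sk}/andP[/eqP Sk tS] := Sk.
transitivity (\sum_(i < n + n) (hor i \in S)%:R * u S).
  apply: eq_bigr => i _; rewrite extE; case: ifP => iS; last by rewrite mul0r.
  by rewrite ctrE !inE eqxx /= finset.setD1K// mulrA sgM.
rewrite -mulr_suml; congr (_ * _); rewrite -natr_sum -Sk; congr (_%:R).
rewrite -sum1_card [RHS]big_mkcond [RHS]big_split_ord /= big_ord1 (negbTE tS) addn0.
by apply: eq_bigr => i _; case: ifP.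
Qed.

Lemma sum_ctr_ext k u : u \in hcov R n k ->
  \sum_i ctr (hor i) (ext (hor i) u) = ((n + n)%:R - k%:R) *: u.
Proof.
move=> uk; rewrite scalerBl -(sum_ext_ctr uk) -sumrN.
rewrite (_ : (n + n)%:R *: u = \sum_(i < n + n) u).
  by rewrite -big_split /=; apply: eq_bigr => i _; rewrite ctr_ext eqxx scale1r.
by rewrite sumr_const card_ord scaler_nat.
Qed.

(** ** The operators L and Lambda *)

Lemma Lop0r : L 0 = 0. Proof. exact: linear0. Qed.
Lemma LopNr u : L (- u) = - L u. Proof. exact: linearN. Qed.
Lemma LopDr u v : L (u + v) = L u + L v. Proof. exact: linearD. Qed.
Lemma LopBr u v : L (u - v) = L u - L v. Proof. exact: linearB. Qed.
Lemma LopZr (a : R) u : L (a *: u) = a *: L u. Proof. exact: linearZ. Qed.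
Lemma Lop_sumr (I : Type) (r : seq I) (P : pred I) (F : I -> V) :
  L (\sum_(k <- r | P k) F k) = \sum_(k <- r | P k) L (F k).
Proof. exact: linear_sum. Qed.

Lemma Lambda0r : M 0 = 0. Proof. exact: linear0. Qed.
Lemma LambdaNr u : M (- u) = - M u. Proof. exact: linearN. Qed.
Lemma LambdaBr u v : M (u - v) = M u - M v. Proof. exact: linearB. Qed.
Lemma LambdaZr (a : R) u : M (a *: u) = a *: M u. Proof. exact: linearZ. Qed.
Lemma Lambda_sumr (I : Type) (r : seq I) (P : pred I) (F : I -> V) :
  M (\sum_(k <- r | P k) F k) = \sum_(k <- r | P k) M (F k).
Proof. exact: linear_sum. Qed.

Lemma LopE u : L u = - \sum_(j < n) ext (ix j) (ext (iy j) u).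
Proof.
rewrite /Lop lfunE /= -[LHS]/(wedger u _) /dtheta linearN linear_sum /=.
by congr (- _); apply: eq_bigr => j _; rewrite /wedger wedge_ext.
Qed.

Lemma dot_Lop u v : dot (L u) v = dot u (M v).
Proof. by rewrite /Lambda [M v]lfunE /= adjointP. Qed.

Lemma LambdaE u : M u = - \sum_(j < n) ctr (iy j) (ctr (ix j) u).
Proof.
apply: dot_inj => v; rewrite -dot_Lop LopE dotC !dotNr !dot_sumr.
by congr (- _); apply: eq_bigr => j _; rewrite dotC !dot_ext.
Qed.

Lemma Lop_ext (i : idx) u : L (ext i u) = ext i (L u).
Proof.
rewrite !LopE extNr ext_sumr; congr (- _).
apply: eq_bigr => j _; rewrite (extC i (ix j)) (extC i (iy j)) extNr opprK.
by [].
Qed.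

Lemma Lambda_ctr (i : idx) u : M (ctr i u) = ctr i (M u).
Proof. by apply: dot_inj => v; rewrite -dot_Lop -!dot_ext -dot_Lop Lop_ext. Qed.

Lemma ctr_ix_Lop (j : 'I_n) u : ctr (ix j) (L u) = L (ctr (ix j) u) - ext (iy j) u.
Proof.
rewrite !LopE ctrNr ctr_sumr -opprD; congr (- _).
rewrite [in LHS](bigD1 j)//= [in RHS](bigD1 j)//= addrAC; congr (_ + _).
  rewrite ctr_ext eqxx scale1r ctr_ext ixy_eq scale0r sub0r extNr opprK.
  by rewrite addrC.
apply: eq_bigr => k kj; rewrite ctr_ext ixy_eq eq_sym (negbTE kj) scale0r sub0r.
by rewrite ctr_ext ixy_eq scale0r sub0r extNr opprK.
Qed.

Lemma ctr_iy_Lop (j : 'I_n) u : ctr (iy j) (L u) = L (ctr (iy j) u) + ext (ix j) u.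
Proof.
rewrite !LopE ctrNr ctr_sumr -[ext (ix j) u]opprK -opprD; congr (- _).
rewrite [in LHS](bigD1 j)//= [in RHS](bigD1 j)//= addrAC; congr (_ + _).
  rewrite ctr_ext ixy_eq scale0r sub0r ctr_ext ixy_eq eqxx scale1r extBr opprB.
  by [].
apply: eq_bigr => k kj; rewrite ctr_ext ixy_eq scale0r sub0r.
by rewrite ctr_ext ixy_eq eq_sym (negbTE kj) scale0r sub0r extNr opprK.
Qed.

Lemma ctr_t_Lop u : ctr t (L u) = L (ctr t u).
Proof.
rewrite !LopE ctrNr ctr_sumr; congr (- _).
apply: eq_bigr => j _.
by rewrite !ctr_ext !t_neq_hor !scale0r !sub0r extNr opprK.
Qed.

(** Up to sign, the contraction with the symplectic dual of the i-th basis
    covector; it is the commutator of Lambda and [ext (hor i)]. *)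
Definition sctr i u : V :=
  match fintype.split i with
  | inl j => - ctr (iy j) u
  | inr j => ctr (ix j) u
  end.

Lemma sctr_is_linear i : linear (sctr i).
Proof.
rewrite /sctr => a u v; case: (fintype.split i) => j; rewrite linearP//.
by rewrite opprD scalerN.
Qed.
HB.instance Definition _ i := GRing.isLinear.Build R V V *:%R (sctr i) (sctr_is_linear i).

Lemma sctr_l (j : 'I_n) u : sctr (lshift n j) u = - ctr (iy j) u.
Proof. by rewrite /sctr (unsplitK (inl _)). Qed.
Lemma sctr_r (j : 'I_n) u : sctr (rshift n j) u = ctr (ix j) u.
Proof. by rewrite /sctr (unsplitK (inr _)). Qed.

Lemma Lambda_ext i u : M (ext (hor i) u) = ext (hor i) (M u) + sctr i u.
Proof.
apply: dot_inj => v; rewrite -dot_Lop -dot_ctr dotDr -dot_ctr.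
rewrite -[i]splitK /unsplit; case: (fintype.split i) => j.
  rewrite sctr_l -[hor _]/(ix j) ctr_ix_Lop dotC dotDr dotNr dotC [dot u _]dotC.
  by rewrite dot_Lop dotNr -dot_ext.
rewrite sctr_r -[hor _]/(iy j) ctr_iy_Lop dotC dotDr dotC [dot u _]dotC.
by rewrite dot_Lop -dot_ext.
Qed.

Lemma Lambda_sctr i u : M (sctr i u) = sctr i (M u).
Proof.
rewrite /sctr; case: (fintype.split i) => j; last by rewrite Lambda_ctr.
by rewrite LambdaNr Lambda_ctr.
Qed.

Lemma sctr_hcov i k u : u \in hcov R n k -> sctr i u \in hcov R n k.-1.
Proof.
by move=> uk; rewrite /sctr; case: (fintype.split i) => j; rewrite ?memvN; exact: ctr_hcov.
Qed.

(** The sl(2) relation: in degree k, the commutator of Lambda and L is n - k.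
    It follows from [Lambda_ext] by moving Lambda through the two factors of
    each term of L. *)
Lemma Lambda_Lop k u : u \in hcov R n k -> M (L u) = L (M u) + (n%:R - k%:R) *: u.
Proof.
move=> uk; rewrite [in LHS]LopE LambdaNr Lambda_sumr [L (M u)]LopE.
rewrite scalerBl -(sum_ext_ctr uk) sum_hor /=.
rewrite (_ : n%:R *: u = \sum_(j < n) u); last first.
  by rewrite sumr_const card_ord scaler_nat.
rewrite -!big_split -!sumrN -!big_split /=; apply: eq_bigr => j _.
rewrite -[ix j]/(hor (lshift n j)) -[iy j]/(hor (rshift n j)) !Lambda_ext.
rewrite sctr_l sctr_r extDr -[hor (lshift n j)]/(ix j) -[hor (rshift n j)]/(iy j).
rewrite ctr_ext eqxx scale1r.
move: (ext _ (ext _ _)) (ext (ix j) (ctr _ _)) (ext (iy j) (ctr _ _)) => a b c.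
by rewrite !opprD !opprK -addrA; congr (_ + _); exact: addrCA.
Qed.

Lemma Lop_hcov k u : u \in hcov R n k -> L u \in hcov R n k.+2.
Proof.
move=> uk; rewrite LopE memvN; apply: memv_suml => j _.
by apply: ext_hcov; apply: ext_hcov.
Qed.

(** Pairing [Lambda_Lop] with u when L u = 0 gives
    |Lambda u|^2 + (n - k) |u|^2 = 0. *)
Lemma Lop_inj k u : u \in hcov R n k -> (k < n)%N -> L u = 0 -> u = 0.
Proof.
move=> uk kn Lu; have := congr1 (dot u) (Lambda_Lop uk).
rewrite Lu Lambda0r dot0r dotDr dotZr [dot u (L _)]dotC dot_Lop => /esym/eqP.
rewrite paddr_eq0 ?dot_self_ge0//; last first.
  by rewrite mulr_ge0 ?dot_self_ge0// subr_ge0 ler_nat ltnW.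
move=> /andP[_]; rewrite mulf_eq0 subr_eq0 eqr_nat gtn_eqF//= => /eqP.
exact: dot_self_eq0.
Qed.

(** Dually, Lambda u = 0 gives |L u|^2 + (k - n) |u|^2 = 0. *)
Lemma Lambda_inj k u : u \in hcov R n k -> (n < k)%N -> M u = 0 -> u = 0.
Proof.
move=> uk kn Mu; have := congr1 (dot u) (Lambda_Lop uk).
rewrite Mu Lop0r add0r dotZr -dot_Lop => /eqP.
rewrite -subr_eq0 -mulNr opprB paddr_eq0 ?dot_self_ge0//; last first.
  by rewrite mulr_ge0 ?dot_self_ge0// subr_ge0 ler_nat ltnW.
move=> /andP[_]; rewrite mulf_eq0 subr_eq0 eqr_nat gtn_eqF//= => /eqP.
exact: dot_self_eq0.
Qed.

(** ** Primitive covectors *)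

(** The sum is -2 Lambda u. *)
Lemma sum_ctr_sctr u : M u = 0 -> \sum_i ctr (hor i) (sctr i u) = 0.
Proof.
move=> Mu; rewrite sum_hor.
have Mu' : \sum_(j < n) ctr (iy j) (ctr (ix j) u) = 0.
  by apply/eqP; rewrite -oppr_eq0 -LambdaE Mu.
rewrite [X in X + _](_ : _ = \sum_(j < n) ctr (iy j) (ctr (ix j) u)).
  rewrite Mu' add0r -[RHS]Mu'; apply: eq_bigr => j _.
  by rewrite sctr_r.
by apply: eq_bigr => j _; rewrite sctr_l ctrNr ctrC opprK.
Qed.

Lemma sum_ctr_Lop_sctr k u : u \in hcov R n k -> M u = 0 ->
  \sum_i ctr (hor i) (L (sctr i u)) = k%:R *: u.
Proof.
move=> uk Mu; rewrite sum_hor -(sum_ext_ctr uk) [RHS]sum_hor.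
have Hl (j : 'I_n) : ctr (hor (lshift n j)) (L (sctr (lshift n j) u)) =
    L (ctr (hor (lshift n j)) (sctr (lshift n j) u)) + ext (iy j) (ctr (iy j) u).
  by rewrite -[hor _]/(ix j) sctr_l LopNr !ctrNr ctr_ix_Lop opprB addrC LopNr.
have Hr (j : 'I_n) : ctr (hor (rshift n j)) (L (sctr (rshift n j) u)) =
    L (ctr (hor (rshift n j)) (sctr (rshift n j) u)) + ext (ix j) (ctr (ix j) u).
  by rewrite -[hor _]/(iy j) sctr_r ctr_iy_Lop.
under eq_bigr do rewrite Hl.
under [X in _ + X = _]eq_bigr do rewrite Hr.
rewrite !big_split /= addrACA -2!Lop_sumr -LopDr.
rewrite -(sum_hor (fun i => ctr (hor i) (sctr i u))) sum_ctr_sctr// Lop0r add0r.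
exact: addrC.
Qed.

(** Both terms have the same image under Lambda: it is C_i u for the first by
    [Lambda_ext], and for the second by [Lambda_Lop] in degree k - 1. *)
Lemma primitive_ext k i u : u \in hcov R n k -> M u = 0 -> (0 < k <= n)%N ->
  M (ext (hor i) u - (n - k.-1)%:R^-1 *: L (sctr i u)) = 0.
Proof.
move=> uk Mu /andP[k_gt0 kn].
have kn' : (k.-1 < n)%N by rewrite prednK.
rewrite LambdaBr LambdaZr Lambda_ext Mu ext0r add0r (Lambda_Lop (sctr_hcov i uk)).
rewrite Lambda_sctr Mu (linear0 (sctr i)) Lop0r add0r -natrB ?(ltnW kn')// scalerA mulVf ?scale1r ?subrr//.
by rewrite pnatr_eq0 subn_eq0 -ltnNge.
Qed.

(** Contracting the hypothesis with the i-th vector and summing over i gives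
    (2n - k) u = k / (n - k + 1) u, and 2n - k > k. *)
Lemma primitive_ext_inj k u : u \in hcov R n k -> M u = 0 -> (0 < k < n)%N ->
  (forall i, ext (hor i) u = (n - k.-1)%:R^-1 *: L (sctr i u)) -> u = 0.
Proof.
move=> uk Mu /andP[k_gt0 kn] H.
have : \sum_i ctr (hor i) (ext (hor i) u) =
    (n - k.-1)%:R^-1 *: \sum_i ctr (hor i) (L (sctr i u)).
  by rewrite scaler_sumr; apply: eq_bigr => i _; rewrite H ctrZr.
rewrite (sum_ctr_ext uk) (sum_ctr_Lop_sctr uk Mu) scalerA => /eqP.
rewrite -subr_eq0 -scalerBl scaler_eq0 => /orP[|/eqP//].
have d_gt0 : 0 < (n - k.-1)%:R :> R by rewrite ltr0n subn_gt0 (leq_ltn_trans (leq_pred _)).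
rewrite gt_eqF// subr_gt0 mulrC ltr_pdivrMr// -natrB; last by lia.
rewrite -natrM ltr_nat; have : (2 <= n - k.-1)%N by lia.
nia.
Qed.

(** The primitive part of [ext (hor i) u] has degree n + 1, where Lambda is
    injective. *)
Lemma primitive_middle_ext i u : u \in hcov R n n -> M u = 0 -> (0 < n)%N ->
  ext (hor i) u = L (sctr i u).
Proof.
move=> un Mu n_gt0; have := primitive_ext i un Mu; rewrite n_gt0 leqnn => /(_ isT).
have -> : (n - n.-1 = 1)%N by lia.
rewrite invr1 scale1r => H.
apply/eqP; rewrite -subr_eq0; apply/eqP; apply: (Lambda_inj _ (ltnSn n)) H.
rewrite rpredB ?ext_hcov//; have := Lop_hcov (sctr_hcov i un).
by rewrite prednK.
Qed.

(** Contracting with the i-th vector and summing over i, the first term gives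
    (n + 1) C_j u and the second one C_j u, by [sum_ctr_sctr].  So every
    contraction of u vanishes, and then so does u, having positive degree. *)
Lemma primitive_middle_inj u : u \in hcov R n n -> M u = 0 -> (0 < n)%N ->
  (forall i j, ext (hor i) (sctr j u) + ext (hor j) (sctr i u) = 0) -> u = 0.
Proof.
move=> un Mu n_gt0 H.
have sctr0 j : sctr j u = 0.
  have : \sum_i ctr (hor i) (ext (hor i) (sctr j u) + ext (hor j) (sctr i u)) = 0.
    by apply: big1 => i _; rewrite H ctr0r.
  under eq_bigr do rewrite ctrDr.
  rewrite big_split /= (sum_ctr_ext (sctr_hcov j un)).
  have -> : \sum_i ctr (hor i) (ext (hor j) (sctr i u)) = sctr j u.
    under eq_bigr do rewrite ctr_ext hor_eq.
    rewrite sumrB -ext_sumr sum_ctr_sctr// ext0r subr0.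
    rewrite (bigD1 j)//= eqxx scale1r big1 ?addr0// => i ij.
    by rewrite (negbTE ij) scale0r.
  rewrite -[X in _ + X]scale1r -scalerDl -natrB; last by lia.
  rewrite natr1 => /eqP; rewrite scaler_eq0 pnatr_eq0 => /orP[//|/eqP//].
have ctr0 i : ctr (hor i) u = 0.
  rewrite -[i]splitK /unsplit; case: (fintype.split i) => j.
    by rewrite -[hor _]/(ix j) -sctr_r.
  by apply/eqP; rewrite -oppr_eq0 -[hor _]/(iy j) -sctr_l sctr0.
have := sum_ext_ctr un; rewrite big1 => [|i _]; last by rewrite ctr0 ext0r.
move=> /esym/eqP; rewrite scaler_eq0 pnatr_eq0 => /orP[|/eqP//].
by rewrite gtn_eqF.
Qed.

End Lefschetz.

(** * Orthogonal projections *)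

Section OrthogonalProjection.
Variables (R : realType) (n : nat).
Local Notation V := (covec R n).
Implicit Types (U : {vspace V}) (u v w : V).

Lemma orthvP U v : reflect (forall u, u \in U -> dot u v = 0) (v \in orthv U).
Proof.
have memP (s : seq V) : reflect (forall u, u \in s -> dot u v = 0)
    (v \in (\bigcap_(u <- s) lker (linfun (dot u : V -> R^o)))%VS).
  elim: s => [|x s IH]; first by rewrite big_nil memvf; constructor.
  rewrite big_cons memv_cap memv_ker lfunE /=; apply: (iffP andP).
    by move=> [/eqP xv /IH sv] u; rewrite inE => /orP[/eqP->//|]; exact: sv.
  move=> H; split; first by apply/eqP/H; rewrite mem_head.
  by apply/IH => u us; apply: H; rewrite inE us orbT.
apply: (iffP (memP _)) => H u uU; last by apply: H; exact: vbasis_mem.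
rewrite (coord_vbasis uU) dotC dot_sumr big1// => i _.
by rewrite dotZr dotC H ?mulr0// mem_nth ?size_tuple.
Qed.

Lemma cap_orthv U : (U :&: orthv U = 0)%VS.
Proof.
apply/eqP; rewrite -subv0; apply/subvP => v /memv_capP[vU /orthvP/(_ v vU)].
by move=> /dot_self_eq0 ->; exact: mem0v.
Qed.

Lemma orthproj_id U u : u \in U -> orthproj U u = u.
Proof. exact: daddv_pi_id (cap_orthv U). Qed.

Lemma orthproj_orthv U v : v \in orthv U -> orthproj U v = 0.
Proof.
move=> vU; have cap := cap_orthv U.
have vUU : v \in (U + orthv U)%VS by exact: (subvP (addvSr U (orthv U))).
have piv : daddv_pi (orthv U) U v = v by apply: daddv_pi_id => //; rewrite capvC.
by have := daddv_pi_add cap vUU; rewrite piv => /(canRL (addrK v)); rewrite subrr.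
Qed.

End OrthogonalProjection.

(** * The exterior derivative in the left-invariant coframe *)

Section Coframe.
Variables (R : realType) (n : nat).
Local Notation H := (Heis R n).
Local Notation idx := 'I_(n + n + 1).
Local Notation V := (covec R n).
Local Notation L := (Lop R n).
Local Notation t := (it n).
Implicit Types (i : 'I_(n + n)) (p : H) (S : {set idx}) (u v w : V) (a : Defs.form R n).

(** The exterior product with dt - theta, the horizontal 1-form
    eta = 1/2 sum (x_j dy_j - y_j dx_j). *)
Definition exteta p u : V := \sum_i Wcoef i p *: ext (hor i) u.

Lemma exteta_is_linear p : linear (exteta p).
Proof.
move=> b u v; rewrite /exteta scaler_sumr -big_split /=; apply: eq_bigr => i _.
by rewrite extDr extZr scalerDr !scalerA mulrC.
Qed.
HB.instance Definition _ p := GRing.isLinear.Build R V V *:%R (exteta p) (exteta_is_linear p).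

Lemma extetaNr p u : exteta p (- u) = - exteta p u.
Proof. exact: (linearN (exteta p)). Qed.
Lemma extetaBr p u v : exteta p (u - v) = exteta p u - exteta p v.
Proof. exact: (linearB (exteta p)). Qed.

Lemma exteta0r p : exteta p 0 = 0. Proof. exact: (linear0 (exteta p)). Qed.
Lemma extetaZr p (b : R) u : exteta p (b *: u) = b *: exteta p u.
Proof. by rewrite linearZ. Qed.

Lemma ext_exteta p (i : idx) u : ext i (exteta p u) = - exteta p (ext i u).
Proof.
rewrite /exteta ext_sumr -sumrN; apply: eq_bigr => k _.
by rewrite extZr extC scalerN.
Qed.

Lemma ctr_t_exteta p u : ctr t (exteta p u) = - exteta p (ctr t u).
Proof.
rewrite /exteta ctr_sumr -sumrN; apply: eq_bigr => k _.
by rewrite ctrZr ctr_ext t_neq_hor scale0r sub0r scalerN.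
Qed.

Lemma eqN_eq0 u : u = - u -> u = 0.
Proof.
move=> /eqP; rewrite -addr_eq0 -mulr2n -scaler_nat scaler_eq0 pnatr_eq0 /=.
by move=> /eqP.
Qed.

Lemma exteta_sqr p u : exteta p (exteta p u) = 0.
Proof.
apply: eqN_eq0; transitivity (\sum_i - exteta p (Wcoef i p *: ext (hor i) u)).
  by apply: eq_bigr => i _; rewrite ext_exteta scalerN extetaZr.
by rewrite sumrN -linear_sum.
Qed.

Lemma ctr_sqr (i : idx) u : ctr i (ctr i u) = 0.
Proof. by apply: eqN_eq0; exact: ctrC. Qed.

(** A monomial contains theta at most once, so replacing theta by dt - eta in it
    subtracts the product of eta with its contraction by T; see [frameE]. *)
Definition shear p u : V := u - exteta p (ctr t u).

(** The change of frame intertwines the products with the left-invariant and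
    the coordinate 1-forms, which is how it is built up monomial by monomial. *)
Lemma wedge_coframe p (i : idx) u :
  wedge (coframe p i) (shear p u) = shear p (ext i u).
Proof.
rewrite -[i]splitK /coframe unsplitK; case: (fintype.split i) => k /=.
  rewrite -[lshift 1 k]/(hor k) /shear.
  rewrite -[wedge _ _]/(ext (hor k) _) extBr ext_exteta ctr_ext t_neq_hor.
  by rewrite scale0r sub0r extetaNr.
have -> : rshift (n + n) k = t by congr rshift; apply/val_inj; case: k => -[].
have wt w : wedge (mono R [set t]%SET - 2^-1 *: \sum_(j < n)
     (p 0 (ix j) *: mono R [set iy j]%SET - p 0 (iy j) *: mono R [set ix j]%SET)) w =
    ext t w - exteta p w.
  have wB (c d : V) : wedge (c - d) w = wedge c w - wedge d w.
    exact: (linearB (wedger w)).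
  have wZ (b : R) (c : V) : wedge (b *: c) w = b *: wedge c w.
    by rewrite -[LHS]/(wedger w _) linearZ.
  have wsum (F : 'I_n -> V) : wedge (\sum_j F j) w = \sum_j wedge (F j) w.
    exact: (linear_sum (wedger w)).
  rewrite wB wZ wsum scaler_sumr /exteta sum_hor -big_split /=; congr (_ - _).
  apply: eq_bigr => j _; rewrite wB !wZ scalerBr !scalerA.
  rewrite /Wcoef (unsplitK (inl _)) (unsplitK (inr _)) scaleNr [RHS]addrC.
  by [].
rewrite wt /shear extBr extetaBr exteta_sqr subr0 ext_exteta opprK.
rewrite ctr_ext eqxx scale1r extetaBr opprB addrA addrAC.
by rewrite addrC addrA [exteta p _ + _]addrC.
Qed.

Lemma ext_mono_min (i : idx) S : (forall k, k \in S -> (i < k)%N) ->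
  ext i (mono R S) = mono R (i |: S)%SET.
Proof.
move=> iS; have iNS : i \notin S by apply/negP => /iS; rewrite ltnn.
apply/ffunP => U; rewrite extE /mono !ffunE; case: ifPn => iU; last first.
  by rewrite (_ : (U == _) = false)//; apply: contraNF iU => /eqP ->; rewrite !inE eqxx.
have -> : (U == (i |: S)%SET) = ((U :\ i)%SET == S).
  by apply/eqP/eqP => [->|<-]; [rewrite finset.setU1K|rewrite finset.setD1K].
case: eqP => [->|_]; last by rewrite mulr0.
rewrite /sg (_ : [set _ in _ | _]%SET = finset.set0) ?cards0 ?mul1r//.
apply/setP => k; rewrite !inE; apply/negbTE/negP => /andP[/iS ik].
by rewrite ltnNge (ltnW ik).
Qed.

Lemma frameE p u : frame p u = shear p u.
Proof.
have lin1 : linear (shear p).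
  move=> b v w; rewrite /shear ctrDr ctrZr linearP /= opprD scalerBr.
  by rewrite addrACA.
have frame_mono (s : seq idx) : sorted ltn [seq val k | k <- s] ->
    \big[@wedge R n/mono R finset.set0]_(k <- s) coframe p k =
    shear p (mono R [set k in s]%SET).
  elim: s => [|i s IH] /= iss.
    rewrite big_nil /shear (_ : [set k in _]%SET = finset.set0).
      rewrite (_ : ctr t _ = 0) ?exteta0r ?subr0//.
      by apply/ffunP => S; rewrite ctrE covec0E ffunE; case: ifP => // _;
        rewrite (_ : (_ == _) = false) ?mulr0//; apply/eqP => /setP/(_ t); rewrite !inE eqxx.
    by apply/setP => k; rewrite !inE.
  rewrite big_cons IH ?(path_sorted iss)// wedge_coframe ext_mono_min.
    by congr (shear _ (mono _ _)); apply/setP => k; rewrite !inE.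
  move=> k; rewrite inE => ks; move: iss; rewrite path_sortedE; last exact: ltn_trans.
  by move=> /andP[/allP/(_ (val k)) + _]; apply; exact: map_f.
pose f1 : {linear V -> V} := HB.pack (shear p) (GRing.isLinear.Build _ _ _ _ _ lin1).
rewrite -[RHS]/(f1 u) [in RHS](covec_mono u) linear_sum; apply: eq_bigr => S _.
rewrite linearZ /= frame_mono; last first.
  rewrite sorted_map {1}/enum_mem; apply: sorted_filter.
    by move=> ? ? ?; exact: ltn_trans.
  rewrite -sorted_map -enumT val_enum_ord; exact: iota_ltn_sorted.
by congr (_ *: shear _ (mono _ _)); apply/setP => k; rewrite inE mem_enum.
Qed.

Lemma frameK p : cancel (frame p) (fun u => u + exteta p (ctr t u)).
Proof.
move=> u; rewrite frameE /shear ctrBr extetaBr ctr_t_exteta ctr_sqr.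
by rewrite exteta0r oppr0 exteta0r subr0 subrK.
Qed.

Lemma invframeK p u : ((linfun (frame p))^-1)%VF (frame p u) = u.
Proof.
rewrite -[frame p u](lfunE (frame p)) lker0_lfunK//; apply/lker0P => v w.
by rewrite !lfunE => /(can_inj (frameK p)).
Qed.

Lemma ext_hor_frame p i u : ext (hor i) (frame p u) = frame p (ext (hor i) u).
Proof.
by rewrite !frameE -wedge_coframe /coframe (unsplitK (inl _)).
Qed.

Lemma exteta_frame p u : exteta p (frame p u) = frame p (exteta p u).
Proof.
rewrite /exteta linear_sum; apply: eq_bigr => i _.
by rewrite linearZ ext_hor_frame.
Qed.

Lemma ext_t_frame p u : ext t (frame p u) = frame p (ext t u + exteta p u).
Proof.
rewrite linearD /= -exteta_frame !frameE /shear extBr extetaBr exteta_sqr subr0.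
rewrite ctr_ext eqxx scale1r ext_exteta opprK extetaBr opprB.
by rewrite addrA subrK.
Qed.

Definition pd_form (k : idx) a : Defs.form R n := fun p => [ffun S => pd k (fun q => a q S) p].
Definition W_form i a : Defs.form R n := fun p => [ffun S => W i (fun q => a q S) p].

Lemma W_formE i a p : W_form i a p = pd_form (hor i) a p + Wcoef i p *: pd_form t a p.
Proof. by apply/ffunP => S; rewrite covecDE covecZE !ffunE WE. Qed.

Lemma linear_coef (f : {linear V -> V}) u S : f u S = \sum_T f (mono R T) S * u T.
Proof.
rewrite {1}(covec_mono u) linear_sum sum_ffunE; apply: eq_bigr => T _.
by rewrite linearZ covecZE mulrC.
Qed.

Lemma smooth_form_linear (f : {linear V -> V}) a : smooth_form a ->
  smooth_form (fun p => f (a p)).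
Proof.
move=> sa S; under eq_fun do rewrite linear_coef.
by apply: smooth_sum => T; exact: smoothMl.
Qed.

Lemma pd_form_linear (f : {linear V -> V}) k a p : smooth_form a ->
  pd_form k (fun q => f (a q)) p = f (pd_form k a p).
Proof.
move=> sa; apply/ffunP => S; rewrite ffunE linear_coef.
under eq_fun do rewrite linear_coef.
rewrite pd_sum => [|T]; last exact: smoothMl.
by apply: eq_bigr => T _; rewrite pdMl ?ffunE//; exact: smooth_differentiable.
Qed.

Lemma pd_form_frame k a p : smooth_form a ->
  pd_form k (fun q => frame q (a q)) p =
  frame p (pd_form k a p) -
    \sum_i pd k (Wcoef i) p *: ext (hor i) (ctr t (a p)).
Proof.
move=> sa.
pose c i : Defs.form R n := fun q => ext (hor i) (ctr t (a q)).
have sc i : smooth_form (c i).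
  by apply: (smooth_form_linear (ext (hor i)) (smooth_form_linear (ctr t) sa)).
have vc i : pd_form k (c i) p = ext (hor i) (ctr t (pd_form k a p)).
  rewrite (@pd_form_linear (ext (hor i)) k (fun q => ctr t (a q))).
    by rewrite (@pd_form_linear (ctr t)).
  exact: (smooth_form_linear (ctr t)).
apply/ffunP => S; rewrite ffunE.
rewrite (_ : (fun q => frame q (a q) S) =
   fun q => a q S + -1 * \sum_i Wcoef i q * c i q S); last first.
  apply/funext => q; rewrite frameE /shear covecDE covecNE mulN1r; congr (_ - _).
  by rewrite sum_ffunE; apply: eq_bigr => i _; rewrite covecZE.
have sWc i : smooth (fun q => Wcoef i q * c i q S).
  by apply: smoothM; [exact: smooth_Wcoef|exact: sc].
have sSum : smooth (fun q => \sum_i Wcoef i q * c i q S) by exact: smooth_sum.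
rewrite pdD; [|exact: smooth_differentiable|apply: smooth_differentiable; exact: smoothMl].
rewrite pdMl ?pd_sum//; last exact: smooth_differentiable.
rewrite frameE /shear /exteta !covecDE !covecNE !sum_ffunE mulN1r -addrA -opprD ffunE.
congr (_ - _); rewrite -big_split /=; apply: eq_bigr => i _.
rewrite pdM; [|exact/smooth_differentiable/smooth_Wcoef|exact/smooth_differentiable/sc].
rewrite !covecZE -vc; congr (_ * _ + _); first by rewrite ffunE.
exact: mulrC.
Qed.

(** d eta = sum dx_j /\ dy_j = - d theta. *)
Lemma sum_ext_pd_Wcoef p u :
  \sum_(k : idx) ext k (\sum_i pd k (Wcoef i) p *: ext (hor i) u) = - L u.
Proof.
have dl (j : 'I_n) (k : idx) : pd k (Wcoef (lshift n j)) p = - 2^-1 * (iy j == k)%:R.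
  rewrite (_ : Wcoef _ = fun q => - 2^-1 * q 0 (iy j)); last first.
    by apply/funext => q; rewrite /Wcoef (unsplitK (inl _)) mulNr.
  by rewrite pdMl ?pd_coord//; exact: differentiable_coord.
have dr (j : 'I_n) (k : idx) : pd k (Wcoef (rshift n j)) p = 2^-1 * (ix j == k)%:R.
  rewrite (_ : Wcoef _ = fun q => 2^-1 * q 0 (ix j)); last first.
    by apply/funext => q; rewrite /Wcoef (unsplitK (inr _)).
  by rewrite pdMl ?pd_coord//; exact: differentiable_coord.
have sum1 (k0 : idx) (c : R) v :
    \sum_(k : idx) ext k ((c * (k0 == k)%:R) *: v) = c *: ext k0 v.
  rewrite (bigD1 k0)//= eqxx mulr1 extZr big1 ?addr0// => k kk0.
  by rewrite eq_sym (negbTE kk0) mulr0 scale0r ext0r.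
under eq_bigr do rewrite ext_sumr.
rewrite exchange_big /= sum_hor LopE opprK -big_split /=.
apply: eq_bigr => j _.
under eq_bigr do rewrite dl.
under [X in _ + X]eq_bigr do rewrite dr.
rewrite !sum1 extC scaleNr scalerN opprK -scalerDl.
by rewrite (_ : 2^-1 + 2^-1 = 1) ?scale1r//; field.
Qed.

(** The three terms are the horizontal derivatives, the derivative along T,
    and the term d theta /\ a_T, where a = ... + theta /\ a_T. *)
Lemma ext_dE a p : smooth_form a ->
  ext_d a p = \sum_i ext (hor i) (W_form i a p) + ext t (pd_form t a p) + L (ctr t (a p)).
Proof.
move=> sa; rewrite /ext_d.
suff -> : coord_d (fun q => frame q (a q)) p =
    frame p (\sum_i ext (hor i) (W_form i a p) + ext t (pd_form t a p) + L (ctr t (a p))).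
  exact: invframeK.
transitivity (\sum_(k : idx) ext k (pd_form k (fun q => frame q (a q)) p)); first by [].
under eq_bigr do rewrite pd_form_frame// extBr.
rewrite sumrB sum_ext_pd_Wcoef opprK linearD /=; congr (_ + _); last first.
  by rewrite frameE /shear ctr_t_Lop ctr_sqr Lop0r exteta0r subr0.
rewrite big_split_ord /= big_ord1 -[rshift _ _]/t ext_t_frame.
under eq_bigr do rewrite -[lshift _ _]/(hor _) ext_hor_frame.
rewrite -linear_sum -linearD /=; congr (frame p _).
rewrite addrCA addrC; congr (_ + _).
rewrite /exteta -big_split /=; apply: eq_bigr => i _.
by rewrite W_formE extDr extZr.
Qed.

End Coframe.

(** * Recovering a covector from its symbols *)

Section Recovery.
Variables (R : realType) (V : vectType R).

(** The coefficients b are the entries of a left inverse of the injective map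
    x |-> (coord_I (B_k (sum_J x_J xi_J)))_(I, k). *)
Lemma recover_coefficients (U U' : {vspace V}) (xi : (\dim U).-tuple V)
    (K : finType) (B : K -> 'End(V)) :
  basis_of U xi ->
  (forall k u, u \in U -> B k u \in U') ->
  (forall u, u \in U -> (forall k, B k u = 0) -> u = 0) ->
  exists b : 'I_(\dim U) -> 'I_(\dim U') -> K -> R,
    forall (x : 'I_(\dim U) -> R) J,
      x J = \sum_I \sum_k
        b J I k * coord (vbasis U') I (B k (\sum_J x J *: tnth xi J)).
Proof.
move=> xiU BU' Binj.
pose comb (x : {ffun 'I_(\dim U) -> R^o}) := \sum_J x J *: tnth xi J.
pose f (x : {ffun 'I_(\dim U) -> R^o}) : {ffun 'I_(\dim U') * K -> R^o} :=
  [ffun Ik => coord (vbasis U') Ik.1 (B Ik.2 (comb x))].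
have f_lin : linear f.
  move=> a x y; apply/ffunP => -[I k]; rewrite !ffunE /= -linearP -linearP.
  congr (coord _ _ (B _ _)); rewrite /comb scaler_sumr -big_split /=.
  by apply: eq_bigr => J _; rewrite !ffunE scalerDl scalerA.
pose F : {linear {ffun 'I_(\dim U) -> R^o} -> {ffun 'I_(\dim U') * K -> R^o}} :=
  HB.pack f (GRing.isLinear.Build _ _ _ _ _ f_lin).
have comb_U x : comb x \in U.
  by apply: memv_suml => J _; apply: memvZ; apply: (basis_mem xiU); exact: mem_tnth.
have F_ker : lker (linfun F) == 0%VS.
  rewrite -subv0; apply/subvP => x; rewrite memv_ker lfunE /= => /eqP Fx0.
  have cx0 : comb x = 0.
    apply: Binj => // k; rewrite (coord_vbasis (BU' k _ (comb_U x))).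
    apply: big1 => I _; have := congr1 (fun g : {ffun _} => g (I, k)) Fx0.
    by rewrite !ffunE /= => ->; rewrite scale0r.
  rewrite memv0; apply/eqP/ffunP => J; rewrite ffunE.
  have := coord_sum_free x J (basis_free xiU).
  rewrite (eq_bigr (fun J => x J *: tnth xi J)) => [|I _].
    by rewrite -/(comb x) cx0 linear0 => <-.
  by rewrite (tnth_nth 0).
pose e (Ik : 'I_(\dim U') * K) : {ffun 'I_(\dim U') * K -> R^o} := [ffun Jl => (Jl == Ik)%:R].
exists (fun J I k => ((linfun F)^-1)%VF (e (I, k)) J) => x J.
have {1}-> : x J = ((linfun F)^-1)%VF (F (finfun (x : _ -> R^o))) J.
  by rewrite -(lfunE F) (lker0_lfunK F_ker) ffunE.
have -> : F (finfun (x : _ -> R^o)) = \sum_Ik F (finfun (x : _ -> R^o)) Ik *: e Ik.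
  apply/ffunP => Ik; rewrite sum_ffunE (bigD1 Ik) //= big1 => [|Jl neq].
    by rewrite !ffunE eqxx addr0 /GRing.scale /= mulr1.
  by rewrite !ffunE eq_sym (negbTE neq) /GRing.scale /= mulr0.
rewrite linear_sum sum_ffunE pair_bigA /=; apply: eq_bigr => -[I k] _.
rewrite linearZ /= !ffunE /GRing.scale /= mulrC; congr (_ * coord _ _ (B _ _)).
by apply: eq_bigr => L _; rewrite ffunE.
Qed.

End Recovery.

(** * The symbol of d_c outside the middle degree *)

Section Rumin.
Variables (R : realType) (n : nat).
Local Notation H := (Heis R n).
Local Notation idx := 'I_(n + n + 1).
Local Notation V := (covec R n).
Local Notation L := (Lop R n).
Local Notation M := (Lambda R n).
Local Notation t := (it n).
Implicit Types (i j : 'I_(n + n)) (p : H) (S : {set idx}) (u v w : V) (a b : Defs.form R n).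

Lemma E0_lowP h u : (h <= n)%N ->
  reflect (u \in hcov R n h /\ M u = 0) (u \in E0 R n h).
Proof.
move=> hn; rewrite /E0 hn memv_cap memv_ker.
by apply: (iffP andP) => -[]; [move=> /eqP|move=> ? /eqP].
Qed.

(** The index of theta is the largest, so theta on the right produces no sign,
    while moving it to the left past k factors gives (-1)^k. *)
Lemma wedge_theta k u : u \in hcov R n k ->
  wedge u (theta R n) = (-1) ^+ k *: ext t u.
Proof.
move=> /hcovP uk; apply/ffunP => U; rewrite covecZE extE ffunE.
case: ifPn => tU; last first.
  rewrite mulr0 big1// => S SU; rewrite /theta ffunE (_ : (_ == _) = false) ?mulr0//.
  apply: contraNF tU => /eqP/setP/(_ t); rewrite !inE eqxx.
  by move=> /andP[].
rewrite (bigD1 (U :\ t)%SET) ?subD1set//= big1 ?addr0.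
  have -> : (U :\: (U :\ t) = [set t])%SET.
    apply/setP => k'; rewrite !inE; have [->|] := eqVneq k' t; first by rewrite tU.
    by case: (k' \in U).
  rewrite /theta ffunE eqxx mulr1.
  have [Uk|/uk ->] := boolP ((#|(U :\ t)%SET| == k) && (t \notin (U :\ t)%SET)); last first.
    by rewrite !mulr0.
  rewrite mulrA; congr (_ * _).
  have lt_t (l : idx) : l != t -> (l < t)%N.
    move=> lt; rewrite ltn_neqAle -val_eqE in lt *.
    by rewrite lt /= addn0 -ltnS -[X in (_ < X)%N]addn1.
  rewrite /wedge_sign /sg.
  rewrite (_ : [set _ in finset.setX _ _ | _]%SET = finset.set0) ?cards0; last first.
    apply/setP => -[l m]; rewrite !inE /=; apply/negbTE/negP.
    move=> /andP[/andP[/andP[/lt_t lt _] /eqP ->]].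
    by rewrite ltnNge (ltnW lt).
  rewrite (_ : [set _ in _ | _]%SET = (U :\ t)%SET); last first.
    apply/setP => l; rewrite !inE; apply/andP/idP => [[]//|lU]; split=> //.
    by apply: lt_t; case/andP: lU.
  by case/andP: Uk => /eqP -> _; rewrite -expr2 -exprM mulnC exprM sqrrN !expr1n.
move=> S /andP[SU SneqU]; rewrite /theta ffunE.
have [E|_] := eqVneq; last by rewrite mulr0.
case/eqP: SneqU; apply/setP => l; rewrite !inE.
have := congr1 (fun A : {set idx} => l \in A) E; rewrite !inE => <-.
case: (boolP (l \in S)) => /= lS; last by rewrite andNb.
by rewrite (fintype.subsetP SU _ lS).
Qed.

Lemma E0_highP h u : (n < h)%N ->
  reflect (exists b : V, [/\ b \in hcov R n h.-1, L b = 0 & u = ext t b]) (u \in E0 R n h).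
Proof.
move=> nh; rewrite /E0 leqNgt nh /=.
have sgn : (-1) ^+ h.-1 * (-1) ^+ h.-1 = 1 :> R.
  by rewrite -expr2 -exprM mulnC exprM sqrrN !expr1n.
apply: (iffP memv_imgP) => -[b].
  rewrite memv_cap memv_ker => /andP[/eqP Lb bh] ->.
  exists ((-1) ^+ h.-1 *: b); split; first exact: memvZ.
    by rewrite LopZr Lb scaler0.
  by rewrite lfunE /= /wedger (wedge_theta bh) extZr.
move=> [bh Lb ->]; exists ((-1) ^+ h.-1 *: b).
  by rewrite memv_cap memv_ker LopZr Lb scaler0 eqxx memvZ.
rewrite lfunE /= /wedger (wedge_theta (memvZ _ bh)).
by rewrite extZr scalerA sgn scale1r.
Qed.

(** ** Derivatives of sections *)

Lemma pd_formD k a b p : smooth_form a -> smooth_form b ->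
  pd_form k (fun q => a q + b q) p = pd_form k a p + pd_form k b p.
Proof.
move=> sa sb; apply/ffunP => S; rewrite covecDE !ffunE.
by under eq_fun do rewrite covecDE; rewrite pdD//; exact: smooth_differentiable.
Qed.

Lemma W_formD i a b p : smooth_form a -> smooth_form b ->
  W_form i (fun q => a q + b q) p = W_form i a p + W_form i b p.
Proof. by move=> sa sb; rewrite !W_formE !pd_formD// scalerDr addrACA. Qed.

Lemma W_form_linear (f : {linear V -> V}) i a p : smooth_form a ->
  W_form i (fun q => f (a q)) p = f (W_form i a p).
Proof. by move=> sa; rewrite !W_formE !pd_form_linear// linearD linearZ. Qed.

Lemma smooth_W_form i a : smooth_form a -> smooth_form (W_form i a).
Proof.
move=> sa S; rewrite (_ : (fun p => W_form i a p S) = W i (fun q => a q S)).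
  exact: smooth_W.
by apply/funext => p; rewrite ffunE.
Qed.

Lemma smooth_formD a b : smooth_form a -> smooth_form b ->
  smooth_form (fun p => a p + b p).
Proof. by move=> sa sb S; under eq_fun do rewrite covecDE; exact: smoothD. Qed.

Lemma smooth_form_sum (I : finType) (F : I -> Defs.form R n) :
  (forall k, smooth_form (F k)) -> smooth_form (fun p => \sum_k F k p).
Proof. by move=> sF S; under eq_fun do rewrite sum_ffunE; apply: smooth_sum => k; exact: sF. Qed.

Lemma W_form_sum (I : finType) (F : I -> Defs.form R n) i p :
  (forall k, smooth_form (F k)) ->
  W_form i (fun q => \sum_k F k q) p = \sum_k W_form i (F k) p.
Proof.
move=> sF; apply/ffunP => S; rewrite ffunE sum_ffunE.
rewrite (_ : (fun q => _) = fun q => \sum_k 1 * F k q S); last first.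
  by apply/funext => q; rewrite sum_ffunE; apply: eq_bigr => k _; rewrite mul1r.
rewrite W_lincomb => [|k]; last exact: sF.
by apply: eq_bigr => k _; rewrite mul1r ffunE.
Qed.

Section Section_of.
Variables (m : nat) (xi : m.-tuple V).
Implicit Types (x : 'I_m -> H -> R).

Lemma section_coef x p S : section_of xi x p S = \sum_J tnth xi J S * x J p.
Proof. by rewrite sum_ffunE; apply: eq_bigr => J _; rewrite covecZE mulrC. Qed.

Lemma smooth_section x : (forall J, smooth (x J)) -> smooth_form (section_of xi x).
Proof.
move=> sx S; under eq_fun do rewrite section_coef.
by apply: smooth_sum => J; exact: smoothMl.
Qed.

Lemma W_form_section i x p : (forall J, smooth (x J)) ->
  W_form i (section_of xi x) p = section_of xi (fun J => W i (x J)) p.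
Proof.
move=> sx; apply/ffunP => S; rewrite ffunE section_coef.
by under eq_fun do rewrite section_coef; rewrite W_lincomb.
Qed.

Lemma pd_form_section k x p : (forall J, smooth (x J)) ->
  pd_form k (section_of xi x) p = section_of xi (fun J => pd k (x J)) p.
Proof.
move=> sx; apply/ffunP => S; rewrite ffunE section_coef.
under eq_fun do rewrite section_coef; rewrite pd_sum => [|J]; last exact: smoothMl.
by apply: eq_bigr => J _; rewrite pdMl//; exact: smooth_differentiable.
Qed.

Lemma section_mem (U : {vspace V}) x p : basis_of U xi -> section_of xi x p \in U.
Proof.
move=> xiU; apply: memv_suml => J _; apply: memvZ.
by apply: (basis_mem xiU); exact: mem_tnth.
Qed.

End Section_of.

Lemma dc_low h a p : (h < n)%N -> smooth_form a ->
  (forall q, a q \in E0 R n h) ->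
  dc h a p = \sum_i orthproj (E0 R n h.+1) (ext (hor i) (W_form i a p)).
Proof.
move=> hn sa ah; rewrite /dc hn ext_dE//.
have [aph _] := E0_lowP _ (ltnW hn) (ah p).
rewrite (ctr_t_hcov aph) Lop0r addr0 linearD linear_sum /=.
rewrite [X in _ + X]orthproj_orthv ?addr0//; apply/orthvP => u /(E0_lowP _ hn)[uh _].
by rewrite -dot_ctr (ctr_t_hcov uh) dotC dot0r.
Qed.

(** The right-hand side is primitive by [primitive_ext], and it differs from
    [ext (hor i) u] by an element of the image of L, which is orthogonal to the
    kernel of Lambda. *)
Lemma orthproj_ext h i u : (0 < h < n)%N -> u \in E0 R n h ->
  orthproj (E0 R n h.+1) (ext (hor i) u) =
  ext (hor i) u - (n - h.-1)%:R^-1 *: L (sctr i u).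
Proof.
move=> /andP[h_gt0 hn] /(E0_lowP _ (ltnW hn))[uh Mu].
set v := _ - _; have vE : v \in E0 R n h.+1.
  apply/(E0_lowP _ hn); split; last by apply: primitive_ext; rewrite ?h_gt0 ?(ltnW hn).
  rewrite rpredB ?ext_hcov// memvZ//.
  by have := Lop_hcov (sctr_hcov i uh); rewrite prednK.
have -> : ext (hor i) u = v + (n - h.-1)%:R^-1 *: L (sctr i u) by rewrite subrK.
rewrite linearD /= (orthproj_id vE) orthproj_orthv ?addr0//.
apply/orthvP => w /(E0_lowP _ hn)[_ Mw].
by rewrite dotZr dotC dot_Lop Mw dot0r mulr0.
Qed.

Lemma symbol_low_inj h u : (0 < h < n)%N -> u \in E0 R n h ->
  (forall i, orthproj (E0 R n h.+1) (ext (hor i) u) = 0) -> u = 0.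
Proof.
move=> hn uE H; case/andP: (hn) => h_gt0 h_lt.
have [uh Mu] := E0_lowP _ (ltnW h_lt) uE.
apply: (primitive_ext_inj uh Mu hn) => i; apply/eqP.
by rewrite -subr_eq0 -orthproj_ext// H.
Qed.

Lemma dc_high h a p : (n < h)%N -> smooth_form a ->
  (forall q, a q \in E0 R n h) -> pd_form t a p \in E0 R n h ->
  dc h a p = \sum_i ext (hor i) (W_form i a p).
Proof.
move=> nh sa ah /(E0_highP _ nh)[c [_ _ tE]]; rewrite /dc ltnNge (ltnW nh) /= gtn_eqF//.
rewrite ext_dE// tE; have [b [bh Lb ->]] := E0_highP _ nh (ah p).
rewrite ext_sqr ctr_ext eqxx scale1r (ctr_t_hcov bh) ext0r subr0 Lb !addr0.
by [].
Qed.

Lemma ext_E0_high h i u : (n < h)%N -> u \in E0 R n h -> ext (hor i) u \in E0 R n h.+1.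
Proof.
move=> nh /(E0_highP _ nh)[b [bh Lb ->]]; apply/E0_highP; first exact: ltnW.
exists (- ext (hor i) b); split; last by rewrite extC extNr.
  by rewrite memvN; have := ext_hcov i bh; rewrite (prednK (leq_ltn_trans _ nh)).
by rewrite LopNr Lop_ext Lb ext0r oppr0.
Qed.

(** [sum_ctr_ext] multiplies a horizontal covector of degree h - 1 by
    2n - h + 1, which is nonzero. *)
Lemma symbol_high_inj h u : (n < h <= 2 * n)%N -> u \in E0 R n h ->
  (forall i, ext (hor i) u = 0) -> u = 0.
Proof.
move=> /andP[nh h2n] /(E0_highP _ nh)[b [bh Lb ->]] H.
have extb i : ext (hor i) b = 0.
  have := congr1 (ctr t) (H i); rewrite extC ctrNr ctr_ext eqxx scale1r ctr0r.
  by rewrite (ctr_t_hcov (ext_hcov i bh)) ext0r subr0 => /eqP; rewrite oppr_eq0 => /eqP.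
have := sum_ctr_ext bh; rewrite big1 => [|i _]; last by rewrite extb ctr0r.
rewrite -natrB; last by lia.
move=> /esym/eqP; rewrite scaler_eq0 pnatr_eq0 => /orP[|/eqP ->]; last exact: ext0r.
by rewrite subn_eq0 => ?; lia.
Qed.

End Rumin.

(** * The symbol of d_c in the middle degree *)

Section MiddleDegree.
Variables (R : realType) (n : nat).
Hypothesis n_gt0 : (0 < n)%N.
Local Notation H := (Heis R n).
Local Notation V := (covec R n).
Local Notation L := (Lop R n).
Local Notation t := (it n).
Implicit Types (i j : 'I_(n + n)) (p : H) (u v w : V) (a b : Defs.form R n).

(** The sign for which b /\ theta = s theta /\ b in degree n - 1. *)
Let s : R := (-1) ^+ n.-1.

Let ss : s * s = 1.
Proof. by rewrite /s -expr2 -exprM mulnC exprM sqrrN !expr1n. Qed.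

Lemma rumin_liftE a b : (forall p, b p \in hcov R n n.-1) ->
  rumin_lift a b = fun p => a p + s *: ext t (b p).
Proof. by move=> bh; apply/funext => p; rewrite /rumin_lift (wedge_theta (bh p)). Qed.

(** The two groups of terms are the part without theta and the multiple of
    theta. *)
Lemma ext_d_lift a b p : smooth_form a -> smooth_form b ->
  (forall q, a q \in hcov R n n) -> (forall q, b q \in hcov R n n.-1) ->
  ext_d (rumin_lift a b) p =
  (\sum_i ext (hor i) (W_form i a p) + s *: L (b p)) +
  ext t (pd_form t a p - s *: \sum_i ext (hor i) (W_form i b p)).
Proof.
move=> sa sb ah bh; rewrite rumin_liftE//.
pose f : {linear V -> V} := s \*: ext t.
have sfb : smooth_form (fun q => f (b q)) by exact: smooth_form_linear.
rewrite ext_dE; last exact: (smooth_formD sa sfb).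
rewrite (@pd_formD _ _ t a (fun q => f (b q)))// (pd_form_linear f)// /f /=.
under eq_bigr do rewrite (@W_formD _ _ _ a (fun q => f (b q)))// (W_form_linear f)// /f /= extDr.
rewrite big_split /= !extDr extZr ext_sqr scaler0 addr0 ctrDr ctrZr.
rewrite (ctr_t_hcov (ah p)) add0r ctr_ext eqxx scale1r (ctr_t_hcov (bh p)).
rewrite ext0r subr0 LopZr extNr.
rewrite (_ : \sum_i ext (hor i) (s *: _) =
    - ext t (s *: \sum_i ext (hor i) (W_form i b p))); last first.
  rewrite extZr ext_sumr scaler_sumr -sumrN; apply: eq_bigr => i _.
  by rewrite extZr extC scalerN.
by rewrite [X in _ = _ + X]addrC addrACA addrA addrAC.
Qed.

(** The defining condition says that the theta-free part of [ext_d_lift]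
    vanishes, that is, s L b = - sum omega_i /\ W_i a, and the right-hand side is
    - L (sum C_i (W_i a)) by [primitive_middle_ext]. *)
Lemma rumin_betaE a : smooth_form a -> (forall p, a p \in E0 R n n) ->
  (forall i p, W_form i a p \in E0 R n n) ->
  rumin_beta a = fun p => - s *: \sum_i sctr i (W_form i a p).
Proof.
move=> sa aE WaE; have nn := leqnn n.
have ah p : a p \in hcov R n n by have [] := E0_lowP _ nn (aE p).
have Wah i p : W_form i a p \in hcov R n n by have [] := E0_lowP _ nn (WaE i p).
have dHa p : \sum_i ext (hor i) (W_form i a p) = L (\sum_i sctr i (W_form i a p)).
  rewrite Lop_sumr; apply: eq_bigr => i _; have [uh Mu] := E0_lowP _ nn (WaE i p).
  exact: primitive_middle_ext.
set b0 := fun p => _.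
have b0h p : b0 p \in hcov R n n.-1.
  by rewrite memvZ// memv_suml// => i _; exact: sctr_hcov.
have sb0 : smooth_form b0.
  apply: (smooth_form_linear (GRing.scale (- s) : {linear V -> V})).
  apply: smooth_form_sum => i; apply: (smooth_form_linear (sctr i)).
  exact: smooth_W_form.
(* L is injective in degree n - 1, which gives uniqueness. *)
have condE b p : smooth_form b -> (forall q, b q \in hcov R n n.-1) ->
    wedge (theta R n) (ext_d (rumin_lift a b) p) = 0 <-> b p = b0 p.
  move=> sb bh; rewrite ext_d_lift// -[wedge (theta R n) _]/(ext t _).
  rewrite [X in X = 0 <-> _]extDr ext_sqr addr0 dHa.
  have -> : L (\sum_i sctr i (W_form i a p)) = - (s *: L (b0 p)).
    by rewrite /b0 LopZr scalerA mulrN ss scaleN1r opprK.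
  rewrite addrC -scalerBr -LopBr extZr.
  have bb0 : b p - b0 p \in hcov R n n.-1 by rewrite rpredB.
  split=> [|->]; last by rewrite subrr Lop0r ext0r scaler0.
  move=> /(congr1 ( *:%R s)); rewrite scalerA ss scale1r scaler0.
  move=> /(congr1 (ctr t)); rewrite ctr_ext eqxx scale1r ctr0r.
  rewrite (ctr_t_hcov (Lop_hcov bb0)) ext0r subr0 => /(Lop_inj bb0).
  by rewrite prednK// => /(_ nn) /eqP; rewrite subr_eq0 => /eqP.
have [sb bh bt] : [/\ smooth_form (rumin_beta a), forall p, rumin_beta a p \in hcov R n n.-1 &
    forall p, wedge (theta R n) (ext_d (rumin_lift a (rumin_beta a)) p) = 0].
  rewrite /rumin_beta; case: xgetP => [b -> //|/(_ b0) []].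
  by split=> // p; apply/condE.
by apply/funext => p; apply/condE.
Qed.

(** An antisymmetric matrix of coefficients expressing T as a second-order
    operator, T = sum kappa_ij W_i W_j, through the commutator [X_1, Y_1]. *)
Definition kappa i j : R :=
  ((i == lshift n (Ordinal n_gt0)) && (j == rshift n (Ordinal n_gt0)))%:R -
  ((i == rshift n (Ordinal n_gt0)) && (j == lshift n (Ordinal n_gt0)))%:R.

Lemma kappa_antisym i j : kappa i j + kappa j i = 0.
Proof.
rewrite /kappa (andbC (j == lshift _ _)) (andbC (j == rshift _ _)).
by rewrite addrA subrK subrr.
Qed.

Lemma pd_form_t_kappa a p : smooth_form a ->
  pd_form t a p = \sum_i \sum_j kappa i j *: W_form i (W_form j a) p.
Proof.
move=> sa; rewrite /kappa.
set x := lshift n _; set y := rshift n _.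
have xy : (x == y) = false by exact: eq_lrshift.
transitivity (W_form x (W_form y a) p - W_form y (W_form x a) p).
  apply/ffunP => S; rewrite covecDE covecNE !ffunE.
  have vWS i : (fun q => W_form i a q S) = W i (fun q => a q S).
    by apply/funext => q; rewrite ffunE.
  by rewrite !vWS; exact/esym/(W_commutator (Ordinal n_gt0))/sa.
have sumd (x0 y0 : 'I_(n + n)) : \sum_i \sum_j ((i == x0) && (j == y0))%:R *: W_form i (W_form j a) p =
    W_form x0 (W_form y0 a) p.
  rewrite (bigD1 x0)//= [X in _ + X]big1 => [|i /negbTE ix]; last first.
    by apply: big1 => j _; rewrite ix scale0r.
  rewrite addr0 (bigD1 y0)//= !eqxx scale1r big1 ?addr0// => j /negbTE jy.
  by rewrite jy andbF scale0r.
rewrite -(sumd x y) -(sumd y x) -sumrB; apply: eq_bigr => i _.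
by rewrite -sumrB; apply: eq_bigr => j _; rewrite scalerBl.
Qed.

Definition mid_symbol i j u : V := ext t (ext (hor i) (sctr j u) + kappa i j *: u).

Lemma mid_symbol_is_linear i j : linear (mid_symbol i j).
Proof.
move=> c u v; rewrite /mid_symbol -extZr -extDr; congr (ext t _).
have -> : sctr j (c *: u + v) = c *: sctr j u + sctr j v by rewrite linearP.
by rewrite extDr extZr !scalerDr !scalerA (mulrC c) addrACA.
Qed.
HB.instance Definition _ i j :=
  GRing.isLinear.Build R V V *:%R (mid_symbol i j) (mid_symbol_is_linear i j).

(** By [ext_d_lift] only theta /\ (T a - s sum omega_i /\ W_i b) is left, and the
    two signs s, here and in [rumin_betaE], cancel. *)
Lemma dc_middle a p : smooth_form a -> (forall q, a q \in E0 R n n) ->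
  (forall i q, W_form i a q \in E0 R n n) ->
  dc n a p = \sum_i \sum_j mid_symbol i j (W_form i (W_form j a) p).
Proof.
move=> sa aE WaE; have nn := leqnn n.
have ah q : a q \in hcov R n n by have [] := E0_lowP _ nn (aE q).
have Wah i q : W_form i a q \in hcov R n n by have [] := E0_lowP _ nn (WaE i q).
rewrite /dc ltnn eqxx (rumin_betaE sa aE WaE).
set b0 := fun p => _.
have sb1 : smooth_form (fun q => \sum_i sctr i (W_form i a q)).
  apply: smooth_form_sum => i; apply: (smooth_form_linear (sctr i)).
  exact: smooth_W_form.
have sb0 : smooth_form b0.
  exact: (smooth_form_linear (GRing.scale (- s) : {linear V -> V})).
have b0h q : b0 q \in hcov R n n.-1.
  by rewrite memvZ// memv_suml// => i _; exact: sctr_hcov.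
rewrite ext_d_lift//.
have -> : \sum_i ext (hor i) (W_form i a p) + s *: L (b0 p) = 0.
  rewrite /b0 LopZr scalerA mulrN ss scaleN1r Lop_sumr.
  apply/eqP; rewrite subr_eq0; apply/eqP; apply: eq_bigr => i _.
  by have [uh Mu] := E0_lowP _ nn (WaE i p); exact: primitive_middle_ext.
have vWb0 i : W_form i b0 p = - s *: \sum_j sctr j (W_form i (W_form j a) p).
  rewrite (@W_form_linear _ _ (GRing.scale (- s) : {linear V -> V}))//=; congr (_ *: _).
  rewrite (@W_form_sum _ _ _ (fun j q => sctr j (W_form j a q))) => [|j]; last first.
    exact/(smooth_form_linear (sctr j))/smooth_W_form.
  apply: eq_bigr => j _; rewrite (W_form_linear (sctr j))//; exact: smooth_W_form.
rewrite add0r pd_form_t_kappa// /mid_symbol.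
under [RHS]eq_bigr do rewrite -ext_sumr big_split.
rewrite -ext_sumr /= big_split /=; congr (ext t _); rewrite [RHS]addrC; congr (_ + _).
rewrite scaler_sumr -sumrN; apply: eq_bigr => i _.
by rewrite vWb0 extZr scalerA mulrN ss scaleN1r opprK ext_sumr.
Qed.

(** Since [kappa] is antisymmetric, T disappears from the symmetric part of the
    symbol; see [sym_symbolE]. *)
Definition sym_symbol (ij : 'I_(n + n) * 'I_(n + n)) : 'End(V) :=
  2^-1 *: (linfun (mid_symbol ij.1 ij.2) + linfun (mid_symbol ij.2 ij.1)).

Lemma sym_symbolE ij u : sym_symbol ij u =
  2^-1 *: ext t (ext (hor ij.1) (sctr ij.2 u) + ext (hor ij.2) (sctr ij.1 u)).
Proof.
rewrite scale_lfunE add_lfunE !lfunE /= /mid_symbol -extDr addrACA -scalerDl.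
by rewrite kappa_antisym scale0r addr0.
Qed.

(** L (omega_i /\ C_j u) = omega_i /\ omega_j /\ u by [primitive_middle_ext], which is
    antisymmetric in i and j. *)
Lemma sym_symbol_E0 ij u : u \in E0 R n n -> sym_symbol ij u \in E0 R n n.+1.
Proof.
move=> /(E0_lowP _ (leqnn n))[uh Mu]; rewrite sym_symbolE; apply: memvZ.
apply/E0_highP => //; exists (ext (hor ij.1) (sctr ij.2 u) + ext (hor ij.2) (sctr ij.1 u)).
split=> //.
  by have := fun i j => ext_hcov i (sctr_hcov j uh); rewrite prednK// => H; rewrite rpredD.
rewrite LopDr !Lop_ext -!(primitive_middle_ext _ uh Mu n_gt0) extC addNr.
by [].
Qed.

Lemma sym_symbol_inj u : u \in E0 R n n -> (forall ij, sym_symbol ij u = 0) -> u = 0.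
Proof.
move=> /(E0_lowP _ (leqnn n))[uh Mu] H.
apply: (primitive_middle_inj uh Mu n_gt0) => i j.
have := H (i, j); rewrite sym_symbolE /= => /eqP.
rewrite scaler_eq0 invr_eq0 pnatr_eq0 /= => /eqP /(congr1 (ctr t)).
rewrite ctr_ext eqxx scale1r ctr0r.
have wh : ext (hor i) (sctr j u) + ext (hor j) (sctr i u) \in hcov R n n.
  by have := fun i j => ext_hcov i (sctr_hcov j uh); rewrite prednK// => E; rewrite rpredD.
by rewrite (ctr_t_hcov wh) ext0r subr0.
Qed.

End MiddleDegree.

(** * Divergence-free representations *)

Section Components.
Variables (R : realType) (n m : nat) (xi : m.-tuple (covec R n)).
Variables (U' : {vspace covec R n}) (A : 'End(covec R n)).
Local Notation V := (covec R n).

(** The I-th component of A xi_J with respect to a fixed basis of U'. *)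
Definition comp_mx (I : 'I_(\dim U')) (J : 'I_m) : R :=
  coord (vbasis U') I (A (tnth xi J)).

Lemma comp_mxE (x : 'I_m -> R) I :
  \sum_J comp_mx I J * x J = coord (vbasis U') I (A (\sum_J x J *: tnth xi J)).
Proof.
by rewrite !linear_sum; apply: eq_bigr => J _; rewrite !linearZ /= mulrC.
Qed.

Lemma smooth_comp (a : 'I_m -> Heis R n -> R) I : (forall J, smooth (a J)) ->
  smooth (fun p => \sum_J comp_mx I J * a J p).
Proof. by move=> sa; apply: smooth_sum => J; exact: smoothMl. Qed.

End Components.

(** The first-order case, for any expression d_c = sum A_i W_i on sections whose
    symbols A_i have no common kernel in E_0^h. *)
Lemma first_order_representation (R : realType) (n h : nat)
    (xi : (\dim (@E0 R n h)).-tuple (covec R n))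
    (A : 'I_(n + n) -> 'End(covec R n)) :
  basis_of (E0 R n h) xi ->
  (forall i u, u \in E0 R n h -> A i u \in E0 R n h.+1) ->
  (forall u, u \in E0 R n h -> (forall i, A i u = 0) -> u = 0) ->
  (forall a p, (forall J, smooth (a J)) ->
     dc h (section_of xi a) p = \sum_i A i (W_form i (section_of xi a) p)) ->
  exists (b : 'I_(\dim (@E0 R n h)) -> 'I_(\dim (@E0 R n h.+1)) ->
              'I_(n + n) -> R) (C : R),
    0 < C /\
    forall a : 'I_(\dim (@E0 R n h)) -> Heis R n -> R,
      (forall J, smooth (a J)) ->
      (forall p, dc h (section_of xi a) p = 0) ->
      exists G : 'I_(\dim (@E0 R n h.+1)) -> 'I_(n + n) -> Heis R n -> R,
        [/\ forall I i, smooth (G I i),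
            forall J p, a J p = \sum_I \sum_i b J I i * G I i p,
            forall I p, \sum_i W i (G I i) p = 0 &
            forall I (q : \bar R), (1 <= q)%E ->
              (Lpnorm q (G I) <= C%:E * Lpnorm q a)%E].
Proof.
move=> xiU AU Ainj dcA.
have [b bP] := recover_coefficients xiU AU Ainj.
have [C C_gt0 CP] := Lpnorm_lincomb_le (n + n + 1)
  (fun (I : 'I_(\dim (E0 R n h.+1))) i J => comp_mx xi (A i) I J).
exists b, C; split=> // a sa dca0.
exists (fun I i p => \sum_J comp_mx xi (A i) I J * a J p); split.
- by move=> I i; exact: smooth_comp.
- move=> J p; rewrite {1}(bP (fun J => a J p) J).
  by apply: eq_bigr => I _; apply: eq_bigr => i _; rewrite comp_mxE.
- move=> I p; transitivity (coord (vbasis (E0 R n h.+1)) I (dc h (section_of xi a) p)).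
    rewrite dcA// linear_sum; apply: eq_bigr => i _.
    by rewrite W_lincomb// comp_mxE W_form_section.
  by rewrite dca0 linear0.
- by move=> I q q_ge1; exact: CP.
Qed.

Theorem theorem5p1 (R : realType) (n h : nat) (n_gt0 : (0 < n)%N)
    (h_range : (1 <= h <= 2 * n)%N)
    (xi : (\dim (@E0 R n h)).-tuple (covec R n))
    (xi_basis : basis_of (@E0 R n h) xi) :
  (h <> n ->
   exists (b : 'I_(\dim (@E0 R n h)) -> 'I_(\dim (@E0 R n h.+1)) ->
               'I_(n + n) -> R) (C : R),
     0 < C /\
     forall a : 'I_(\dim (@E0 R n h)) -> Heis R n -> R,
       (forall J, smooth (a J)) ->
       (forall p, dc h (section_of xi a) p = 0) ->
       exists G : 'I_(\dim (@E0 R n h.+1)) -> 'I_(n + n) -> Heis R n -> R,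
         [/\ forall I i, smooth (G I i),
             forall J p, a J p = \sum_I \sum_i b J I i * G I i p,
             forall I p, \sum_i W i (G I i) p = 0 &
             forall I (q : \bar R), (1 <= q)%E ->
               (Lpnorm q (G I) <= C%:E * Lpnorm q a)%E]) /\
  (h = n ->
   exists (b : 'I_(\dim (@E0 R n h)) -> 'I_(\dim (@E0 R n h.+1)) ->
               'I_(n + n) -> 'I_(n + n) -> R) (C : R),
     0 < C /\
     forall a : 'I_(\dim (@E0 R n h)) -> Heis R n -> R,
       (forall J, smooth (a J)) ->
       (forall p, dc h (section_of xi a) p = 0) ->
       exists G : 'I_(\dim (@E0 R n h.+1)) -> 'I_(n + n) -> 'I_(n + n) ->
                  Heis R n -> R,
         [/\ forall I i j, smooth (G I i j),
             forall J p, a J p = \sum_I \sum_i \sum_j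
               b J I i j * (2^-1 * (G I i j p + G I j i p)),
             forall I p, \sum_i \sum_j W i (W j (G I i j)) p = 0 &
             forall I (q : \bar R), (1 <= q)%E ->
               (Lpnorm q (fun ij : 'I_(n + n) * 'I_(n + n) =>
                            G I ij.1 ij.2) <= C%:E * Lpnorm q a)%E]).
Proof.
have /andP[h_gt0 h2n] := h_range.
have secE (a : 'I_(\dim (E0 R n h)) -> Heis R n -> R) p :
    section_of xi a p \in E0 R n h by exact: section_mem.
split=> [/eqP hn|hn].
  case: (ltngtP h n) hn => // [hn|nh] _.
    have h_low : (0 < h < n)%N by rewrite h_gt0.
    apply: (@first_order_representation _ _ _ _
      (fun i => orthproj (E0 R n h.+1) \o linfun (ext (hor i)))%VF) => //.
    - by move=> i u _; rewrite comp_lfunE; exact: memv_pi.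
    - move=> u uE H; apply: (symbol_low_inj h_low uE) => i.
      by have := H i; rewrite comp_lfunE lfunE.
    - move=> a p sa; rewrite dc_low//; last exact: smooth_section.
      by apply: eq_bigr => i _; rewrite comp_lfunE lfunE.
  have h_high : (n < h <= 2 * n)%N by rewrite nh.
  apply: (@first_order_representation _ _ _ _ (fun i => linfun (ext (hor i)))) => //.
  - by move=> i u uE; rewrite lfunE; exact: ext_E0_high.
  - move=> u uE H; apply: (symbol_high_inj h_high uE) => i.
    by have := H i; rewrite lfunE.
  - move=> a p sa; rewrite dc_high//; first by apply: eq_bigr => i _; rewrite lfunE.
      exact: smooth_section.
    by rewrite pd_form_section.
subst h.
pose A i j : 'End(covec R n) := linfun (mid_symbol n_gt0 i j).
have [b bP] := recover_coefficients xi_basis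
  (fun ij u => @sym_symbol_E0 R n n_gt0 ij u) (@sym_symbol_inj R n n_gt0).
have [C C_gt0 CP] := Lpnorm_lincomb_le (n + n + 1)
  (fun (I : 'I_(\dim (E0 R n n.+1))) (ij : 'I_(n + n) * 'I_(n + n)) J => comp_mx xi (A ij.1 ij.2) I J).
exists (fun J I i j => b J I (i, j)), C; split=> // a sa dca0.
exists (fun I i j p => \sum_J comp_mx xi (A i j) I J * a J p); split.
- by move=> I i j; exact: smooth_comp.
- move=> J p; rewrite {1}(bP (fun J => a J p) J).
  apply: eq_bigr => I _; rewrite pair_bigA; apply: eq_bigr => -[i j] _ /=.
  by rewrite !comp_mxE /sym_symbol scale_lfunE add_lfunE linearZ linearD.
- move=> I p; transitivity (coord (vbasis (E0 R n n.+1)) I (dc n (section_of xi a) p)).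
    have vWE i : W_form i (section_of xi a) = section_of xi (fun J => W i (a J)).
      by apply/funext => q; exact: W_form_section.
    rewrite dc_middle//; last 2 first.
    + exact: smooth_section.
    + by move=> i q; rewrite vWE.
    rewrite linear_sum; apply: eq_bigr => i _; rewrite linear_sum; apply: eq_bigr => j _.
    rewrite (_ : W j _ = fun q => \sum_J comp_mx xi (A i j) I J * W j (a J) q).
      rewrite W_lincomb => [|J]; last exact: smooth_W.
      rewrite comp_mxE vWE W_form_section ?lfunE// => J; exact: smooth_W.
    by apply/funext => q; exact: W_lincomb.
  by rewrite dca0 linear0.
- by move=> I q q_ge1; exact: CP.
Qed.
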